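(* For every $n\ge 3$, the symmetrized polydisc $\mathbb G_n$ does not belong to the class $\mathcal E$.
   Context: Let $\mathbb D$ be the open unit disc and $\sigma=(\sigma_1,\dots,\sigma_n):\mathbb C^n\to\mathbb C^n$, $\sigma_k(z_1,\dots,z_n)=\sum_{1\le j_1<\dots<j_k\le n}z_{j_1}\cdots z_{j_k}$. The symmetrized polydisc is $\mathbb G_n=\sigma(\mathbb D^n)$. $\mathcal E$ is the class of domains that can be exhausted by domains biholomorphic to convex domains, i.e. $D\in\mathcal E$ if for every compact $K\subset D$ there is a domain $D'$ with $K\subset D'\subset D$ that is biholomorphic to a convex domain. *)

(* Defs.v *)
From HB Require Import structures.
From mathcomp Require Import all_boot all_order all_algebra.
From mathcomp Require Import all_classical all_reals all_analysis.
From mathcomp Require Import complex.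

Set Implicit Arguments.
Unset Strict Implicit.
Unset Printing Implicit Defensive.

Import Order.TTheory GRing.Theory Num.Theory.
Import numFieldNormedType.Exports.

Local Open Scope classical_set_scope.
Local Open Scope ring_scope.

(* R[i] itself carries no topology in the libraries; packed as a
   numClosedFieldType it gets the topology of the norm `|_|, hence 'rV[Cplx R]_n
   (the model of C^n) is a normed module over Cplx R, and [differentiable] between
   such spaces is complex differentiability. *)
Definition Cplx (R : realType) : numClosedFieldType := R[i].

Definition is_domain (R : realType) (n : nat) (D : set 'rV[Cplx R]_n) : Prop :=
  [/\ open D, connected D & D !=set0].

(* Only the values of f on D matter when D is open. *)
Definition holomorphic_on (R : realType) (n m : nat) (D : set 'rV[Cplx R]_n)
    (f : 'rV[Cplx R]_n -> 'rV[Cplx R]_m) : Prop :=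
  forall z, D z -> differentiable f z.

Definition biholomorphic (R : realType) (n : nat)
    (D1 D2 : set 'rV[Cplx R]_n) : Prop :=
  exists f g : 'rV[Cplx R]_n -> 'rV[Cplx R]_n,
    [/\ holomorphic_on D1 f /\ holomorphic_on D2 g,
        {homo f : z / D1 z >-> D2 z},
        {homo g : w / D2 w >-> D1 w},
        forall z, D1 z -> g (f z) = z
      & forall w, D2 w -> f (g w) = w].

(* The weights in [convex_set] are the t : Cplx R with 0 <= t <= 1; in the order
   of R[i] these are the real numbers of [0, 1], so this is convexity of G in
   the underlying real vector space. *)
Definition is_convex_domain (R : realType) (n : nat)
    (G : set 'rV[Cplx R]_n) : Prop :=
  is_domain G /\ convex_set (G : set (convex_lmodType 'rV[Cplx R]_n)).

Definition class_E (R : realType) (n : nat) (D : set 'rV[Cplx R]_n) : Prop :=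
  is_domain D /\
  forall K : set 'rV[Cplx R]_n, compact K -> K `<=` D ->
    exists D' : set 'rV[Cplx R]_n,
      [/\ is_domain D', K `<=` D', D' `<=` D
        & exists2 G : set 'rV[Cplx R]_n,
            is_convex_domain G & biholomorphic D' G].

Definition polydisc (R : realType) (n : nat) : set 'rV[Cplx R]_n :=
  [set z : 'rV[Cplx R]_n | forall j, `|z ord0 j| < 1].

(* The coordinate k : 'I_n is the elementary symmetric polynomial of degree
   k + 1; increasing tuples j_1 < ... < j_(k+1) are encoded as subsets. *)
Definition symmetrization (R : realType) (n : nat)
    (z : 'rV[Cplx R]_n) : 'rV[Cplx R]_n :=
  \row_(k < n) \sum_(J : {set 'I_n} | #|J| == k.+1) \prod_(j in J) z ord0 j.

Definition symmetrized_polydisc (R : realType) (n : nat) : set 'rV[Cplx R]_n :=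
  @symmetrization R n @` @polydisc R n.

(* Main.v *)
Require Import Defs.
From mathcomp Require Import all_boot all_order all_algebra.
From mathcomp Require Import all_classical all_reals all_analysis.
From mathcomp Require Import complex.
From mathcomp Require Import ring lra zify.

(** Write G for the symmetrized polydisc in dimension n >= 3.  Its points are,
up to signs, the coefficient vectors of the monic polynomials of degree n whose
roots all lie in the open unit disc, and G is stable under the weighted scalings
[wscale t] : x_j |-> t^j x_j (with j counted from 1) for |t| <= 1, which scale
the roots by t.

Choose p < q <= n < 2p and consider the slice of the vectors [tri p q a b], that
is, of the trinomials z^n + a z^(n-p) + b z^(n-q).  The idea is that, if G could
be exhausted by domains biholomorphic to convex domains, then midpoints of the
slice would stay in the closure of G; but the slice is not convex.

Midpoints.  Let x = tri p q a b and y = tri p q a' b' belong to G, with midpoint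
c.  The orbits x(t), y(t) of x and y under [wscale t], |t| <= 1, form a compact
set, hence lie in a domain D' inside G with a biholomorphic f : D' -> (convex)
and inverse g.  Put Gm(t) = g ((f (x t) + f (y t)) / 2), a point of G.  Since f
has bounded second differences and g is Lipschitz near the base points
([biholomorphic_midpoint]), Gm(t) = wscale t c + O(|x t - y t|^2), and the error
is O(|t|^(2p)).  As 2p > n, the map h(t) = wscale t^-1 (Gm t) therefore extends
continuously to t = 0 by h(0) = c, while h(t) belongs to G for |t| = 1.  So
every polynomial function P satisfies |P(c)| <= sup |P| over G, by the mean value
property on the unit circle; [slice_midpoint_bound] says this for the functions
x |-> linrec x M 0.  These are the terms of the linear recurrence with
characteristic polynomial [sym_poly x]: on G they grow polynomially in M
([linrec_bound]), but at a real c whose polynomial has a root beyond 1 they grow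
exponentially ([tri_linrec_lower]).

Non-convexity.  It remains to find a trinomial with roots in the open disc,
such that averaging it with its complex conjugate gives a trinomial with a root
larger than 1, that is, 1 + Re a + Re b < 0.  With p = dk and q = (d+1)k this
reduces to trinomials z^(d+1) + a z + b; the values d = 2 and d = 3 suffice
for all n >= 3, and explicit examples are checked with the Schur-Cohn recursion
([stable_cubic], [stable_quartic]).

Complex analysis.  Holomorphy only means complex differentiability, so Cauchy
theory is built from Goursat's theorem.  In logarithmic coordinates s + it a
circle is a segment of length 2 pi and periodicity makes two sides of the
rectangle cancel, so Goursat's theorem for rectangles ([flux_zero]) shows that
circular means do not depend on the radius ([circle_mean]).  The maximum
principle and the Schwarz lemma follow, and two applications of the Schwarz
lemma bound second differences ([second_difference]). *)

Set Implicit Arguments.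
Unset Strict Implicit.
Unset Printing Implicit Defensive.

Import Order.TTheory GRing.Theory Num.Theory.
Import numFieldNormedType.Exports.

Local Open Scope classical_set_scope.
Local Open Scope ring_scope.

(** * Complex numbers in real coordinates *)

Section Coordinates.
Variable R : realType.
Local Notation C := (Cplx R).
Local Open Scope complex_scope.
Implicit Types (x y : R) (z w : C).

Definition cx x y : C := x +i* y.
Definition re z : R := complex.Re z.
Definition im z : R := complex.Im z.

(** The norm of [Cplx R] takes its values in [Cplx R]; [rabs] is the same modulus
as a real number, so that real arithmetic applies to estimates. *)
Definition rabs z : R := Num.sqrt (re z ^+ 2 + im z ^+ 2).

Definition cj z : C := cx (re z) (- im z).

Lemma norm_rabs z : `|z| = cx (rabs z) 0.
Proof. exact: (normc_def z). Qed.

Lemma cx_le x y : (cx x 0 <= cx y 0) = (x <= y).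
Proof. exact: lecR. Qed.

Lemma cx_lt x y : (cx x 0 < cx y 0) = (x < y).
Proof. exact: ltcR. Qed.

Lemma cx_gt0P (e : C) : 0 < e -> exists2 r : R, 0 < r & e = cx r 0.
Proof.
rewrite -[0 < e]/((0 : R[i]) < e) ltcE => /andP[/eqP e1 e2].
by exists (re e) => //; rewrite /cx /re; case: e e1 e2 => a b /= -> _.
Qed.

Lemma re_cx x y : re (cx x y) = x. Proof. by []. Qed.
Lemma im_cx x y : im (cx x y) = y. Proof. by []. Qed.
Lemma cx_eta z : cx (re z) (im z) = z. Proof. by case: z. Qed.
Lemma cxD x y x' y' : cx x y + cx x' y' = cx (x + x') (y + y').
Proof. by []. Qed.
Lemma cxN x y : - cx x y = cx (- x) (- y). Proof. by []. Qed.
Lemma cxM x y x' y' :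
  cx x y * cx x' y' = cx (x * x' - y * y') (x * y' + y * x').
Proof. by []. Qed.
Lemma cx0 : cx 0 0 = 0. Proof. by []. Qed.
Lemma cx1 : cx 1 0 = 1. Proof. by []. Qed.
Lemma reD z w : re (z + w) = re z + re w. Proof. by case: z; case: w. Qed.
Lemma imD z w : im (z + w) = im z + im w. Proof. by case: z; case: w. Qed.
Lemma reN z : re (- z) = - re z. Proof. by case: z. Qed.
Lemma imN z : im (- z) = - im z. Proof. by case: z. Qed.
Lemma reM z w : re (z * w) = re z * re w - im z * im w.
Proof. by case: z; case: w. Qed.
Lemma imM z w : im (z * w) = re z * im w + im z * re w.
Proof. by case: z; case: w. Qed.

Lemma rabs_sqr z : rabs z ^+ 2 = re z ^+ 2 + im z ^+ 2.
Proof. by rewrite /rabs sqr_sqrtr // addr_ge0 // sqr_ge0. Qed.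
Lemma re_rabs z : `|re z| <= rabs z.
Proof. by rewrite -sqrtr_sqr ler_wsqrtr // lerDl sqr_ge0. Qed.
Lemma im_rabs z : `|im z| <= rabs z.
Proof. by rewrite -sqrtr_sqr ler_wsqrtr // lerDr sqr_ge0. Qed.
Lemma rabs_ge0 z : 0 <= rabs z. Proof. exact: sqrtr_ge0. Qed.

Lemma rabs_le z (r : R) : (rabs z <= r) = (`|z| <= cx r 0).
Proof. by rewrite norm_rabs cx_le. Qed.
Lemma rabs_lt z (r : R) : (rabs z < r) = (`|z| < cx r 0).
Proof. by rewrite norm_rabs cx_lt. Qed.

Lemma rabs0 : rabs 0 = 0.
Proof. by rewrite /rabs expr0n /= addr0 sqrtr0. Qed.
Lemma rabs1 : rabs 1 = 1.
Proof. by rewrite /rabs -cx1 re_cx im_cx expr1n expr0n addr0 sqrtr1. Qed.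

Lemma rabs_eq0 z : (rabs z == 0) = (z == 0).
Proof.
rewrite -[RHS]normr_eq0 norm_rabs; apply/eqP/eqP => [->|]; first exact: cx0.
by rewrite -cx0 => -[].
Qed.

Lemma rabs_gt0 z : (0 < rabs z) = (z != 0).
Proof. by rewrite lt0r rabs_eq0 rabs_ge0 andbT. Qed.

Lemma rabsD z w : rabs (z + w) <= rabs z + rabs w.
Proof.
have := ler_normD z w; rewrite !norm_rabs.
by rewrite cxD addr0 cx_le.
Qed.

Lemma rabsM z w : rabs (z * w) = rabs z * rabs w.
Proof.
have := normrM z w; rewrite !norm_rabs cxM !(mulr0, mul0r) subr0 addr0.
by case.
Qed.

Lemma rabsN z : rabs (- z) = rabs z.
Proof. by have := normrN z; rewrite !norm_rabs => -[]. Qed.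

Lemma rabsX z k : rabs (z ^+ k) = rabs z ^+ k.
Proof.
elim: k => [|k IH]; last by rewrite !exprS rabsM IH.
by rewrite !expr0 rabs1.
Qed.

Lemma rabsV z : z != 0 -> rabs z^-1 = (rabs z)^-1.
Proof.
move=> z0; have zz : rabs z != 0 by rewrite rabs_eq0.
by apply: (mulfI zz); rewrite -rabsM !divff // rabs1.
Qed.

Lemma rabs_le_dist z w : rabs z - rabs w <= rabs (z - w).
Proof. by have := rabsD (z - w) w; rewrite subrK lerBlDr. Qed.

Lemma rabs_cx x y : rabs (cx x y) <= `|x| + `|y|.
Proof.
have -> : cx x y = cx x 0 + cx 0 y by rewrite cxD addr0 add0r.
apply: le_trans (rabsD _ _) _; rewrite /rabs !re_cx !im_cx expr0n /= addr0 add0r.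
by rewrite !sqrtr_sqr.
Qed.

Lemma rabs_lt1 z : re z ^+ 2 + im z ^+ 2 < 1 -> rabs z < 1.
Proof.
by rewrite -rabs_sqr -[X in _ < X](expr1n _ 2) ltr_pXn2r ?nnegrE ?rabs_ge0.
Qed.

Lemma cjK z : cj (cj z) = z.
Proof. by rewrite /cj re_cx im_cx opprK cx_eta. Qed.
Lemma cjD z w : cj (z + w) = cj z + cj w.
Proof. by rewrite /cj reD imD opprD. Qed.
Lemma cjM z w : cj (z * w) = cj z * cj w.
Proof. by rewrite /cj reM imM cxM; congr cx; ring. Qed.
Lemma cj0 : cj 0 = 0. Proof. by rewrite -cx0 /cj re_cx im_cx oppr0. Qed.
Lemma cj_exp z k : cj (z ^+ k) = cj z ^+ k.
Proof.
elim: k => [|k IH]; last by rewrite !exprS cjM IH.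
by rewrite !expr0 -cx1 /cj re_cx im_cx oppr0.
Qed.
Lemma rabs_cj z : rabs (cj z) = rabs z.
Proof. by rewrite /rabs re_cx im_cx sqrrN. Qed.

End Coordinates.

(** * Integrals over segments *)

Definition itv_int (R : realType) (a b : R) (u : R -> R) : R :=
  \int[lebesgue_measure]_(x in `[a, b]) u x.

Definition cont_on (R : realType) (a b : R) (u : R -> R) : Prop :=
  forall x, a <= x <= b -> {for x, continuous u}.

Section IntervalIntegral.
Variable R : realType.
Implicit Types (a b c : R) (u v : R -> R).
Local Notation mu := (@lebesgue_measure R).

Lemma cont_on_integrable a b u :
  cont_on a b u -> mu.-integrable `[a, b] (EFin \o u).
Proof.
move=> cu; apply: continuous_compact_integrable; first exact: segment_compact.
by apply: continuous_in_subspaceT => x; rewrite inE /= in_itv /= => /cu.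
Qed.

Lemma cont_onB a b u v :
  cont_on a b u -> cont_on a b v -> cont_on a b (fun x => u x - v x).
Proof. by move=> cu cv x xab; apply: continuousB; [exact: cu | exact: cv]. Qed.

Lemma itv_intB a b u v : cont_on a b u -> cont_on a b v ->
  itv_int a b (fun x => u x - v x) = itv_int a b u - itv_int a b v.
Proof.
by move=> cu cv; apply: RintegralB => //; apply: cont_on_integrable.
Qed.

Lemma itv_int_split a b c u : a <= c <= b -> cont_on a b u ->
  itv_int a b u = itv_int a c u + itv_int c b u.
Proof.
move=> /andP[ac cb] cu; have iu := cont_on_integrable cu.
have := Rintegral_itvB (x := c) iu.
rewrite !bnd_simp => /(_ ac cb) E.
rewrite /itv_int -(@Rintegral_itv_obnd_cbnd _ c); first by rewrite -E addrC subrK.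
by apply: integrableS iu => //; apply: subset_itv; rewrite !bnd_simp.
Qed.

Lemma itv_int_le a b u k : a <= b -> cont_on a b u ->
  (forall x, a <= x <= b -> u x <= k) -> itv_int a b u <= k * (b - a).
Proof.
move=> ab cu uk.
have ck : cont_on a b (cst k) by move=> x _; exact: cst_continuous.
have -> : k * (b - a) = itv_int a b (cst k).
  rewrite /itv_int Rintegral_cst //= lebesgue_measure_itv /= lte_fin.
  by case: ltgtP ab => //= <- _; rewrite subrr.
by apply: le_Rintegral => //=; exact: cont_on_integrable.
Qed.

Lemma itv_int_near_cst a b u k e : a <= b -> cont_on a b u ->
  (forall x, a <= x <= b -> `|u x - k| <= e) ->
  `|itv_int a b u - k * (b - a)| <= e * (b - a).
Proof.
move=> ab cu uk.
have uk' x (hx : a <= x <= b) : - e <= u x - k <= e by rewrite -ler_norml uk.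
have c0 : cont_on a b (fun=> 0) by move=> x _; exact: cst_continuous.
have le : itv_int a b u <= (k + e) * (b - a).
  by apply: itv_int_le => // x /uk'; lra.
have ge : itv_int a b (fun x => 0 - u x) <= (e - k) * (b - a).
  by apply: itv_int_le => //; [exact: cont_onB | move=> x /uk'; lra].
have z' : itv_int a b (fun=> 0) = 0 by rewrite /itv_int /Rintegral integral0.
move: ge; rewrite itv_intB // z' => ge.
by rewrite ler_norml; apply/andP; split; lra.
Qed.

End IntervalIntegral.

(** * Goursat's theorem on rectangles *)

Section Flux.
Variable R : realType.
Implicit Types (U V : R -> R -> R).

(** The outward flux of the vector field (U, - V) through the boundary of the
rectangle [s0, s1] x [t0, t1]. *)
Definition flux U V s0 s1 t0 t1 : R :=
  itv_int t0 t1 (fun t => U s1 t - U s0 t) -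
  itv_int s0 s1 (fun s => V s t1 - V s t0).

Definition approx_at U (s t a b e : R) (s' t' : R) : Prop :=
  `|U s' t' - U s t - a * (s' - s) - b * (t' - t)|
    <= e * (`|s' - s| + `|t' - t|).

(** Pointwise differentiability of U and V, with dU/ds = dV/dt = a.  For U + i V
holomorphic this equality is one of the two Cauchy-Riemann equations. *)
Definition div_free_at U V (s t : R) : Prop :=
  exists a b c : R, forall e : R, 0 < e -> exists2 d : R, 0 < d &
    forall s' t', `|s' - s| < d -> `|t' - t| < d ->
      approx_at U s t a b e s' t' /\ approx_at V s t c a e s' t'.

Lemma line_continuous (u : R -> R) (x a : R) :
  (forall e : R, 0 < e -> exists2 d : R, 0 < d & forall y, `|y - x| < d ->
     `|u y - u x - a * (y - x)| <= e * `|y - x|) -> {for x, continuous u}.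
Proof.
move=> h; apply/cvgrPdist_le => e e0.
have [d d0 hd] := h 1 ltr01.
pose M := `|a| + 1.
have M0 : 0 < M by rewrite ltr_pwDr.
have /= := @nbhsx_ballx _ _ x (Num.min d (e / M)).
rewrite lt_min d0 divr_gt0 // => /(_ isT); apply: filterS => y.
rewrite /ball /= lt_min distrC => /andP[yd ye].
rewrite distrC; have := hd y yd; rewrite mul1r => hy.
have -> : u y - u x = (u y - u x - a * (y - x)) + a * (y - x) by ring.
apply: le_trans (ler_normD _ _) _; rewrite normrM.
apply: le_trans (lerD hy (lexx _)) _.
rewrite -[X in X + _]mul1r -mulrDl addrC -/M mulrC -ler_pdivlMr //.
exact: ltW.
Qed.

Lemma div_free_contU1 U V s t : div_free_at U V s t ->
  {for t, continuous (U s)}.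
Proof.
move=> [a [b [c h]]]; apply: (@line_continuous _ _ b) => e e0.
have [d d0 hd] := h e e0; exists d => // y yd.
have [||+ _] := hd s y; rewrite ?subrr ?normr0 //.
by rewrite /approx_at subrr mulr0 subr0 normr0 add0r.
Qed.

Lemma div_free_contV2 U V s t : div_free_at U V s t ->
  {for s, continuous (V ^~ t)}.
Proof.
move=> [a [b [c h]]]; apply: (@line_continuous _ _ c) => e e0.
have [d d0 hd] := h e e0; exists d => // y yd.
have [||_ +] := hd y t; rewrite ?subrr ?normr0 //.
by rewrite /approx_at subrr mulr0 subr0 normr0 addr0.
Qed.

Section Rect.
Variables (U V : R -> R -> R) (s0 s1 t0 t1 : R).
Hypothesis UV : forall s t, s0 <= s <= s1 -> t0 <= t <= t1 -> div_free_at U V s t.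

Lemma rect_contU a b s : s0 <= s <= s1 -> t0 <= a -> b <= t1 ->
  cont_on a b (U s).
Proof.
move=> hs ta tb x /andP[ax xb]; apply: (div_free_contU1 (V := V)); apply: UV => //.
by rewrite (le_trans ta ax) (le_trans xb tb).
Qed.

Lemma rect_contV a b t : t0 <= t <= t1 -> s0 <= a -> b <= s1 ->
  cont_on a b (V ^~ t).
Proof.
move=> hs ta tb x /andP[ax xb]; apply: (div_free_contV2 (U := U)); apply: UV => //.
by rewrite (le_trans ta ax) (le_trans xb tb).
Qed.

Lemma flux_split a b c d m n : s0 <= a -> a <= m -> m <= b -> b <= s1 ->
  t0 <= c -> c <= n -> n <= d -> d <= t1 ->
  flux U V a b c d = (flux U V a m c n + flux U V m b c n)
                   + (flux U V a m n d + flux U V m b n d).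
Proof.
move=> sa am mb bs tc cn nd dt.
have sm := le_trans sa am; have ms := le_trans mb bs.
have sb := le_trans sm mb; have as_ := le_trans am ms.
have tn := le_trans tc cn; have nt := le_trans nd dt.
have td := le_trans tn nd; have ct := le_trans cn nt.
have cU s p q : s0 <= s -> s <= s1 -> t0 <= p -> q <= t1 -> cont_on p q (U s).
  by move=> h1 h2; apply: rect_contU; rewrite h1 h2.
have cV s p q : t0 <= s -> s <= t1 -> s0 <= p -> q <= s1 -> cont_on p q (V ^~ s).
  by move=> h1 h2; apply: rect_contV; rewrite h1 h2.
rewrite /flux !itv_intB; try by [apply: cU | apply: cV].
rewrite (itv_int_split (c := n) (a := c) (b := d) (u := U b)) ?cn ?nd //;
  last exact: cU.
rewrite (itv_int_split (c := n) (a := c) (b := d) (u := U a)) ?cn ?nd //;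
  last exact: cU.
rewrite (itv_int_split (c := m) (a := a) (b := b) (u := V ^~ c)) ?am ?mb //;
  last exact: cV.
rewrite (itv_int_split (c := m) (a := a) (b := b) (u := V ^~ d)) ?am ?mb //;
  last exact: cV.
ring.
Qed.

(** The affine parts contribute [a * (b - a) * (f - c)] to both terms of the
flux, so only the error terms remain: each is o(size), integrated over a segment
of length O(size). *)
Lemma flux_small (s t e : R) : s0 <= s <= s1 -> t0 <= t <= t1 -> 0 < e ->
  exists2 d : R, 0 < d & forall a b c f, s0 <= a -> a <= s -> s <= b -> b <= s1 ->
    t0 <= c -> c <= t -> t <= f -> f <= t1 -> b - a < d -> f - c < d ->
    `|flux U V a b c f| <= e * ((b - a) + (f - c)) ^+ 2.
Proof.
move=> hs ht e0; have [al [be [ga h]]] := UV hs ht.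
have e2 : 0 < e / 2 by rewrite divr_gt0.
have [d d0 hd] := h (e / 2) e2; exists d => // a b c f.
move=> sa as_ sb bs tc ct tf ft bad fcd.
have ab := le_trans as_ sb; have cf := le_trans ct tf.
have sb' := le_trans sa ab; have as' := le_trans ab bs.
have tf' := le_trans tc cf; have ct' := le_trans cf ft.
pose L := (b - a) + (f - c).
have near x y : a <= x <= b -> c <= y <= f ->
    approx_at U s t al be (e / 2) x y /\ approx_at V s t ga al (e / 2) x y.
  move=> /andP[ax xb] /andP[cy yf].
  by apply: hd; rewrite ltr_norml; apply/andP; split; lra.
have dist x y : a <= x <= b -> c <= y <= f -> `|x - s| + `|y - t| <= L.
  move=> /andP[ax xb] /andP[cy yf]; rewrite /L; apply: lerD.
    by rewrite ler_norml; apply/andP; split; lra.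
  by rewrite ler_norml; apply/andP; split; lra.
have ha : a <= a <= b by rewrite lexx.
have hb : a <= b <= b by rewrite lexx ab.
have hc : c <= c <= f by rewrite lexx.
have hf : c <= f <= f by rewrite lexx cf.
have est (W : R -> R -> R) p q x y x' y' : 
    approx_at W s t p q (e / 2) x y -> approx_at W s t p q (e / 2) x' y' ->
    `|x - s| + `|y - t| <= L -> `|x' - s| + `|y' - t| <= L ->
    `|(W x y - W x' y') - (p * (x - x') + q * (y - y'))| <= e * L.
  rewrite /approx_at => h1 h2 l1 l2.
  have -> : W x y - W x' y' - (p * (x - x') + q * (y - y')) =
    (W x y - W s t - p * (x - s) - q * (y - t)) -
    (W x' y' - W s t - p * (x' - s) - q * (y' - t)) by ring.
  apply: le_trans (ler_normB _ _) _; apply: le_trans (lerD h1 h2) _.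
  rewrite -mulrDr; apply: le_trans (_ : e / 2 * (L + L) <= _); last by lra.
  by apply: ler_wpM2l; [rewrite divr_ge0 // ltW | exact: lerD].
have I1 : `|itv_int c f (fun y => U b y - U a y) - al * (b - a) * (f - c)|
          <= e * L * (f - c).
  apply: itv_int_near_cst => //.
    by apply: cont_onB; apply: rect_contU; rewrite ?sb' ?as' ?sa ?bs.
  move=> y hy; have [h1 _] := near b y hb hy; have [h2 _] := near a y ha hy.
  by have := est U _ _ _ _ _ _ h1 h2 (dist _ _ hb hy) (dist _ _ ha hy);
    rewrite subrr mulr0 addr0.
have I2 : `|itv_int a b (fun x => V x f - V x c) - al * (f - c) * (b - a)|
          <= e * L * (b - a).
  apply: itv_int_near_cst => //.
    by apply: cont_onB; apply: rect_contV; rewrite ?tf' ?ct' ?tc ?ft.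
  move=> x hx; have [_ h1] := near x f hx hf; have [_ h2] := near x c hx hc.
  by have := est V _ _ _ _ _ _ h1 h2 (dist _ _ hx hf) (dist _ _ hx hc);
    rewrite subrr mulr0 add0r.
rewrite /flux -/L.
set A := itv_int c f _ in I1 *; set B := itv_int a b _ in I2 *.
have -> : A - B = (A - al * (b - a) * (f - c)) - (B - al * (f - c) * (b - a)) by ring.
apply: le_trans (ler_normB _ _) _; apply: le_trans (lerD I1 I2) _.
rewrite -mulrDr (addrC (f - c)) -/L; rewrite expr2 mulrA; exact: lexx.
Qed.

End Rect.

(** Subdivision step of Goursat's argument: one of the four quarters carries at
least a quarter of the flux. *)
Lemma flux_quarter U V s0 s1 t0 t1 (s t w h e : R) :
  (forall s t, s0 <= s <= s1 -> t0 <= t <= t1 -> div_free_at U V s t) ->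
  0 <= w -> 0 <= h -> s0 <= s -> s + w <= s1 -> t0 <= t -> t + h <= t1 ->
  e < `|flux U V s (s + w) t (t + h)| ->
  exists s' t', [/\ s <= s', s' + w / 2 <= s + w, t <= t', t' + h / 2 <= t + h &
     e / 4 < `|flux U V s' (s' + w / 2) t' (t' + h / 2)|].
Proof.
move=> UV w0 h0 s0s sw t0t th.
have hE (x r : R) : x + r = (x + r / 2) + r / 2 by field.
rewrite (@flux_split _ _ _ _ _ _ UV _ _ _ _ (s + w / 2) (t + h / 2)) //; try lra.
rewrite (hE s w) (hE t h) => big.
set A := flux _ _ s _ t _ in big; set B := flux _ _ _ _ t _ in big.
set C := flux _ _ s _ _ _ in big; set D := flux _ _ _ _ _ _ in big.
have tri : `|A + B + (C + D)| <= `|A| + `|B| + (`|C| + `|D|).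
  by apply: le_trans (ler_normD _ _) _; apply: lerD; exact: ler_normD.
have [hA|hA] := ltP (e / 4) `|A|; first by exists s, t; split; rewrite -/A //; lra.
have [hB|hB] := ltP (e / 4) `|B|.
  by exists (s + w / 2), t; split; rewrite -/B //; lra.
have [hC|hC] := ltP (e / 4) `|C|.
  by exists s, (t + h / 2); split; rewrite -/C //; lra.
have [hD|hD] := ltP (e / 4) `|D|.
  by exists (s + w / 2), (t + h / 2); split; rewrite -/D //; lra.
by exfalso; lra.
Qed.

End Flux.

Lemma nested_itv_point (R : realType) (x w : nat -> R) :
  (forall k, 0 <= w k) -> (forall k, x k <= x k.+1) ->
  (forall k, x k.+1 + w k.+1 <= x k + w k) ->
  exists y, forall k, x k <= y <= x k + w k.
Proof.
move=> w0 xle xwle.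
have mono k j : x k <= x (k + j)%N /\ x (k + j)%N + w (k + j)%N <= x k + w k.
  elim: j => [|j [h1 h2]]; first by rewrite addn0.
  by rewrite addnS (le_trans h1) ?xle // (le_trans (xwle _)).
have ub k j : x j <= x k + w k.
  have [/subnKC <-|/ltnW /subnKC <-] := leqP k j.
    have [_] := mono k (j - k)%N; apply: le_trans; by rewrite lerDl.
  have [h _] := mono j (k - j)%N; apply: le_trans h _; by rewrite lerDl.
exists (sup (range x)) => k; apply/andP; split.
  apply: ub_le_sup; last by exists k.
  by exists (x 0%N + w 0%N) => _ [j _ <-].
apply: ge_sup; first by exists (x 0%N), 0%N.
by move=> _ [j _ <-].
Qed.

Lemma half_pow_lt (R : realType) (w d : R) : 0 <= w -> 0 < d ->
  exists k, w / 2 ^+ k < d.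
Proof.
move=> w0 d0.
have [n hn] : exists n : nat, w / d < n%:R.
  exists (Num.truncn (w / d)).+1; exact: truncnS_gt.
exists n; rewrite ltr_pdivrMr ?exprn_gt0 // mulrC -ltr_pdivrMr //.
apply: lt_trans hn _; rewrite -natrX ltr_nat; exact: ltn_expl.
Qed.

(** Goursat's theorem, in its divergence form.  A nonzero flux yields nested
rectangles, halved in size at each step, whose k-th flux exceeds c / 4^k for a
constant c > 0; at their common point this contradicts [flux_small]. *)
Lemma flux_zero (R : realType) (U V : R -> R -> R) s0 s1 t0 t1 :
  s0 <= s1 -> t0 <= t1 ->
  (forall s t, s0 <= s <= s1 -> t0 <= t <= t1 -> div_free_at U V s t) ->
  flux U V s0 s1 t0 t1 = 0.
Proof.
move=> s01 t01 UV; apply/eqP/negP => /negP F0.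
pose w := s1 - s0; pose h := t1 - t0.
have w0 : 0 <= w by rewrite subr_ge0.
have h0 : 0 <= h by rewrite subr_ge0.
pose e : R := `|flux U V s0 s1 t0 t1| / 2.
have e0 : 0 < e by rewrite divr_gt0 // normr_gt0.
pose inv k (p : R * R) := [/\ s0 <= p.1, p.1 + w / 2 ^+ k <= s1,
  t0 <= p.2, p.2 + h / 2 ^+ k <= t1 &
  e / 4 ^+ k < `|flux U V p.1 (p.1 + w / 2 ^+ k) p.2 (p.2 + h / 2 ^+ k)|].
pose step k (p q : R * R) := inv k p -> [/\ inv k.+1 q,
  p.1 <= q.1, q.1 + w / 2 ^+ k.+1 <= p.1 + w / 2 ^+ k,
  p.2 <= q.2 & q.2 + h / 2 ^+ k.+1 <= p.2 + h / 2 ^+ k].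
have half (x : R) k : x / 2 ^+ k.+1 = x / 2 ^+ k / 2.
  by rewrite exprS invfM [2^-1 * _]mulrC mulrA.
have quart k : e / 4 ^+ k.+1 = e / 4 ^+ k / 4.
  by rewrite exprS invfM [4^-1 * _]mulrC mulrA.
have wk k : 0 <= w / 2 ^+ k by rewrite divr_ge0 // exprn_ge0.
have hk k : 0 <= h / 2 ^+ k by rewrite divr_ge0 // exprn_ge0.
have stepE (kp : nat * (R * R)) : exists q, step kp.1 kp.2 q.
  case: kp => k p /=; have [ip|nip] := pselect (inv k p); last by exists p.
  have [a1 a2 a3 a4 a5] := ip.
  have [s' [t' [b1 b2 b3 b4 b5]]] := flux_quarter UV (wk k) (hk k) a1 a2 a3 a4 a5.
  exists (s', t') => _; rewrite /inv !half quart /=; split=> //; split=> //.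
  - exact: le_trans b1.
  - exact: le_trans b2 _.
  - exact: le_trans b3.
  - exact: le_trans b4 _.
have [f hf] := choice stepE.
pose p := fix p k := if k is k'.+1 then f (k', p k') else (s0, t0).
have pinv k : inv k (p k).
  elim: k => [|k IH]; last by have [] := hf (k, p k) IH.
  rewrite /inv /= !expr0 !divr1 /w /h !(addrC s0) !(addrC t0) !subrK; split=> //.
  by have := e0; rewrite /e; lra.
have pst k := hf (k, p k) (pinv k).
have [sx hsx] : exists y, forall k, (p k).1 <= y <= (p k).1 + w / 2 ^+ k.
  by apply: nested_itv_point => [//|k|k]; have [_ h1 h2 h3 h4] := pst k.
have [tx htx] : exists y, forall k, (p k).2 <= y <= (p k).2 + h / 2 ^+ k.
  by apply: nested_itv_point => [//|k|k]; have [_ h1 h2 h3 h4] := pst k.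
have hs : s0 <= sx <= s1.
  by have := hsx 0%N; rewrite /= expr0 divr1 /w addrC subrK.
have ht : t0 <= tx <= t1.
  by have := htx 0%N; rewrite /= expr0 divr1 /h addrC subrK.
pose e' := e / (w + h + 1) ^+ 2.
have wh1 : 0 < w + h + 1 by lra.
have e'0 : 0 < e' by rewrite divr_gt0 // exprn_gt0.
have [d d0 hd] := flux_small UV hs ht e'0.
have [k hk'] := half_pow_lt (addr_ge0 w0 h0) d0.
have [c1 c2 c3 c4 c5] := pinv k.
have /andP[d1 d2] := hsx k; have /andP[d3 d4] := htx k.
have whk : w / 2 ^+ k + h / 2 ^+ k < d by rewrite -mulrDl.
have wkk := wk k; have hkk := hk k.
have := hd _ _ _ _ c1 d1 d2 c2 c3 d3 d4 c4.
rewrite ![_ + _ / _ - _]addrAC !subrr !add0r.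
have X1 : w / 2 ^+ k < d by lra.
have X2 : h / 2 ^+ k < d by lra.
move=> /(_ X1 X2) /(lt_le_trans c5); apply/negP; rewrite -leNgt.
rewrite -mulrDl expr_div_n mulrA -exprM mulnC exprM.
have -> : 2 ^+ 2 = 4 :> R by ring.
apply: ler_wpM2r; first by rewrite invr_ge0 exprn_ge0.
rewrite /e' mulrAC ler_pdivrMr ?exprn_gt0 //.
apply: ler_wpM2l; first exact: ltW.
by apply: lerXn2r; rewrite ?nnegrE; lra.
Qed.

(** * Mean values on circles *)

Lemma is_derive_estimate (K : numFieldType) (f : K -> K) (x a : K) :
  is_derive x (1 : K) f a ->
  forall e : K, 0 < e -> exists2 d : K, 0 < d &
    forall h, `|h| < d -> `|f (x + h) - f x - a * h| <= e * `|h|.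
Proof.
move=> [df fa] e e0; move: df; rewrite /derivable /= => cf.
have {}cf : (fun h : K => h^-1 *: ((f \o shift x) (h *: 1) - f x)) @ 0^' --> a.
  by rewrite -fa; exact: cf.
have /cvgrPdist_le /(_ e e0) /= := cf.
rewrite /prop_near1 /= nbhs_filterE /= => /nbhs_ballP[d /= d0 hd].
exists d => // h hd'.
have [->|h0] := eqVneq h 0; first by rewrite addr0 subrr mulr0 subr0 normr0 mulr0.
have := hd h; rewrite /ball /= sub0r normrN => /(_ hd' h0).
rewrite /GRing.scale /= mulr1 (addrC h x) => H.
have -> : f (x + h) - f x - a * h = - ((a - h^-1 * (f (x + h) - f x)) * h).
  by rewrite mulrBl mulrAC mulVf // mul1r opprB.
by rewrite normrN normrM; apply: ler_wpM2r.
Qed.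

Section Polar.
Variable R : realType.
Local Notation C := (Cplx R).

(** The complex exponential exp (s + i t). *)
Definition polar (s t : R) : C := cx (expR s * cos t) (expR s * sin t).

Lemma rabs_polar s t : rabs (polar s t) = expR s.
Proof.
rewrite /rabs /polar /= !exprMn -mulrDr cos2Dsin2 mulr1 sqrtr_sqr.
by apply: ger0_norm; exact: expR_ge0.
Qed.

Lemma polarD s t x y : polar (s + x) (t + y) = polar s t * polar x y.
Proof. by rewrite /polar cxM expRD cosD sinD; congr cx; ring. Qed.

Lemma polar_2pi s : polar s (pi *+ 2) = polar s 0.
Proof. by rewrite /polar cos2pi sin2pi cos0 sin0. Qed.

(** The exponential has derivative 1 at 0; with [polarD] this makes it complex
differentiable everywhere. *)
Lemma polar_near0 (e : R) : 0 < e -> exists2 d : R, 0 < d &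
  forall x y, `|x| < d -> `|y| < d ->
  rabs (polar x y - 1 - cx x y) <= e * (`|x| + `|y|).
Proof.
move=> e0.
have := is_derive_estimate (is_derive_expR (0 : R)).
rewrite expR0 => hexp.
have := is_derive_estimate (is_derive_cos (0 : R)).
rewrite sin0 oppr0 cos0 => hcos.
have := is_derive_estimate (is_derive_sin (0 : R)).
rewrite sin0 cos0 => hsin.
have e4 : 0 < e / 8 by rewrite divr_gt0.
have [d1 d10 h1] := hexp _ e4.
have [d2 d20 h2] := hcos _ e4.
have [d3 d30 h3] := hsin _ e4.
have [d4 d40 h4] := hexp 1 ltr01.
pose d := Num.min (Num.min d1 d2) (Num.min (Num.min d3 d4) (Num.min (1/2) (e/8))).
exists d => [|x y].
  by rewrite !lt_min d10 d20 d30 d40 /= e4 divr_gt0.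
rewrite !lt_min => /andP[/andP[x1 x2] /andP[/andP[x3 x4] /andP[x5 x6]]].
move=> /andP[/andP[y1 y2] /andP[/andP[y3 y4] /andP[y5 y6]]].
have := h1 x x1; rewrite add0r mul1r => E1.
have := h2 y y2; rewrite add0r mul0r subr0 => E2.
have := h3 y y3; rewrite add0r mul1r subr0 => E3.
have := h4 x x4; rewrite add0r !mul1r => E4.
have nx := normr_ge0 x; have ny := normr_ge0 y.
have Ex1 : `|expR x - 1| <= 2 * `|x|.
  have -> : expR x - 1 = (expR x - 1 - x) + x by ring.
  by apply: le_trans (ler_normD _ _) _; lra.
have Ex : `|expR x| <= 2.
  have -> : expR x = (expR x - 1) + 1 by ring.
  by apply: le_trans (ler_normD _ _) _; rewrite normr1; lra.
have nE := normr_ge0 (expR x).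
have -> : polar x y - 1 - cx x y =
   cx (expR x * cos y - 1 - x) (expR x * sin y - y).
  by rewrite /polar -cx1 !cxN !cxD subr0.
apply: le_trans (rabs_cx _ _) _.
have A : `|expR x * cos y - 1 - x| <= e / 8 * `|x| + 2 * (e / 8 * `|y|).
  have -> : expR x * cos y - 1 - x = (expR x - 1 - x) + expR x * (cos y - 1) by ring.
  apply: le_trans (ler_normD _ _) _; apply: lerD => //.
  by rewrite normrM; apply: ler_pM.
have B : `|expR x * sin y - y| <= 2 * (e / 8 * `|y|) + 2 * (e / 8) * `|y|.
  have -> : expR x * sin y - y = expR x * (sin y - y) + (expR x - 1) * y by ring.
  apply: le_trans (ler_normD _ _) _; apply: lerD.
    by rewrite normrM; apply: ler_pM.
  rewrite normrM; apply: ler_pM => //; lra.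
apply: le_trans (lerD A B) _.
have := mulr_ge0 (ltW e0) nx; have := mulr_ge0 (ltW e0) ny; lra.
Qed.

End Polar.

Section Mean.
Variable R : realType.
Local Notation C := (Cplx R).
Implicit Types (Q : C -> C) (z w : C).

Definition rcont Q w := forall e : R, 0 < e -> exists2 d : R, 0 < d &
  forall z, rabs (z - w) < d -> rabs (Q z - Q w) <= e.

Lemma derivable_rabs_estimate Q z : derivable Q z 1 -> exists a : C,
  forall e : R, 0 < e -> exists2 d : R, 0 < d &
    forall h, rabs h < d -> rabs (Q (z + h) - Q z - a * h) <= e * rabs h.
Proof.
move=> /derivableP /is_derive_estimate H; exists ('D_1 Q z) => e e0.
have [|d /cx_gt0P[r r0 ->] h] := H (cx e 0); first by rewrite -cx0 cx_lt.
exists r => // x; rewrite rabs_lt => /h.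
by rewrite !norm_rabs cxM !(mul0r, mulr0) subr0 addr0 cx_le.
Qed.

(** In the coordinates s + i t the function z |-> Q (w + exp z) is holomorphic,
with derivative D = a * exp z, so its real and imaginary parts satisfy the
Cauchy-Riemann equations. *)
Lemma polar_div_free Q w s t : derivable Q (w + polar s t) 1 ->
  div_free_at (fun s t => re (Q (w + polar s t)))
              (fun s t => im (Q (w + polar s t))) s t.
Proof.
move=> /derivable_rabs_estimate[a ha].
pose P : C := polar s t; pose D : C := a * P.
exists (re D), (- im D), (im D) => e e0.
pose p := rabs P; pose m := rabs a.
have p0 : 0 <= p by exact: rabs_ge0.
have m0 : 0 <= m by exact: rabs_ge0.
have mp0 : 0 <= m * p by exact: mulr_ge0.
pose e1 := Num.min 1 (e / (2 * (m * p + 1))).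
have e10 : 0 < e1 by rewrite lt_min ltr01 divr_gt0 // mulr_gt0 // ltr_wpDl.
have e2 : 0 < e / (4 * (p + 1)) by rewrite divr_gt0 // mulr_gt0 // ltr_wpDl.
have [d1 d10 h1] := polar_near0 e10.
have [d2 d20 h2] := ha _ e2.
have p10 : 0 < 4 * (p + 1) by rewrite mulr_gt0 // ltr_wpDl.
pose d := Num.min d1 (d2 / (4 * (p + 1))).
exists d => [|s' t']; first by rewrite lt_min d10 divr_gt0.
rewrite !lt_min => /andP[x1 x2] /andP[y1 y2].
pose x := s' - s; pose y := t' - t.
rewrite -/x -/y in x1 x2 y1 y2.
have Hr := h1 x y x1 y1.
pose L := `|x| + `|y|.
have L0 : 0 <= L by exact: addr_ge0.
rewrite -/L in Hr.
pose r : C := polar x y - 1 - cx x y.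
rewrite -/r in Hr.
pose h : C := P * (cx x y + r).
have Eh : polar s' t' = P + h.
  have -> : s' = s + x by rewrite /x; ring.
  have -> : t' = t + y by rewrite /y; ring.
  by rewrite polarD /h /r addrCA subrr addr0 mulrBr mulr1 addrC subrK.
have hL : rabs h <= 2 * p * L.
  rewrite /h rabsM -/p (mulrC 2) -mulrA; apply: ler_wpM2l => //.
  apply: le_trans (rabsD _ _) _.
  have := rabs_cx x y; rewrite -/L => hc.
  have : e1 * L <= 1 * L by apply: ler_wpM2r => //; rewrite ge_min lexx.
  lra.
have hd : rabs h < d2.
  apply: le_lt_trans hL _.
  have : L < 2 * (d2 / (4 * (p + 1))) by rewrite /L; lra.
  rewrite mulrA ltr_pdivlMr // => HL.
  have : 0 <= L * 1 by rewrite mulr1. 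
  lra.
have H := h2 h hd.
have key : rabs (Q (w + polar s' t') - Q (w + polar s t) - D * cx x y) <= e * L.
  rewrite Eh -/P addrA.
  have -> : Q (w + P + h) - Q (w + P) - D * cx x y =
     (Q (w + P + h) - Q (w + P) - a * h) + D * r.
    by rewrite /h /D mulrDr mulrDr !mulrA opprD !addrA subrK.
  apply: le_trans (rabsD _ _) _.
  have -> : e * L = e / 2 * L + e / 2 * L by field.
  apply: lerD.
    apply: le_trans H _.
    rewrite -ler_pdivlMl //; apply: le_trans hL _.
    have -> : (e / (4 * (p + 1)))^-1 * (e / 2 * L) = 2 * (p + 1) * L.
      by field; rewrite !lt0r_neq0 // ltr_wpDl.
    by apply: ler_wpM2r => //; lra.
  rewrite /D !rabsM -/m -/p.
  apply: le_trans (_ : m * p * (e1 * L) <= _); first exact: ler_wpM2l.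
  rewrite mulrA; apply: ler_wpM2r => //.
  have : e1 <= e / (2 * (m * p + 1)) by rewrite ge_min lexx orbT.
  rewrite ler_pdivlMr; last by rewrite mulr_gt0 // ltr_wpDl.
  lra.
split; apply: le_trans key.
- apply: le_trans (re_rabs _); rewrite !(reD, reN, reM) re_cx im_cx -/x -/y.
  by rewrite le_eqVlt; apply/orP; left; apply/eqP; congr `|_|; ring.
- apply: le_trans (im_rabs _); rewrite !(imD, imN, imM) re_cx im_cx -/x -/y.
  by rewrite le_eqVlt; apply/orP; left; apply/eqP; congr `|_|; ring.
Qed.

(** Weak form of the mean value property: Re Q (w) does not exceed the maximum of
Re Q over the circle.  If it did by eta, the flux over the logarithmic
rectangle between that circle and a very small one would be nonzero: the
horizontal sides cancel by periodicity, and on the small circle Q is within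
eta / 2 of Q w.  The centre may be an exceptional point, at which Q is only
continuous; this takes the place of a removable singularity theorem. *)
Lemma circle_mean Q w (r eta : R) : 0 < r -> 0 < eta ->
  (forall z, 0 < rabs (z - w) <= r -> derivable Q z 1) -> rcont Q w ->
  exists2 z, rabs (z - w) = r & re (Q w) - eta < re (Q z).
Proof.
move=> r0 eta0 dQ cQ; apply: contrapT => H.
have {}H z : rabs (z - w) = r -> re (Q z) <= re (Q w) - eta.
  by move=> zr; rewrite leNgt; apply/negP => h; apply: H; exists z.
have eta2 : 0 < eta / 2 by rewrite divr_gt0.
have [d d0 hd] := cQ _ eta2.
pose s1 := ln r; pose s0 := Num.min s1 (ln (d / 2)).
have es1 : expR s1 = r by rewrite lnK.
have es0 : expR s0 <= d / 2.
  by rewrite -[leRHS]lnK ?posrE ?divr_gt0 // ler_expR ge_min lexx orbT.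
have s01 : s0 <= s1 by rewrite ge_min lexx.
pose U s t := re (Q (w + polar s t)); pose V s t := im (Q (w + polar s t)).
pose T : R := pi *+ 2.
have T0 : 0 < T by rewrite /T mulrn_wgt0 // pi_gt0.
have wK s t : rabs (w + polar s t - w) = expR s.
  by rewrite addrAC subrr add0r rabs_polar.
have UV s t : s0 <= s <= s1 -> 0 <= t <= T -> div_free_at U V s t.
  move=> /andP[_ hs] _; apply: polar_div_free; apply: dQ.
  by rewrite wK expR_gt0 -es1 ler_expR.
have := flux_zero s01 (ltW T0) UV; rewrite /flux.
have -> : itv_int s0 s1 (fun s => V s T - V s 0) = 0.
  have -> : (fun s => V s T - V s 0) = fun=> 0.
    by apply/funext => s; rewrite /V /T polar_2pi subrr.
  by rewrite /itv_int /Rintegral integral0.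
have : itv_int 0 T (fun t => U s1 t - U s0 t) <= - (eta / 2) * (T - 0).
  apply: itv_int_le; first exact: ltW.
    apply: cont_onB; apply: (rect_contU UV); rewrite ?s01 ?lexx //.
  move=> t _.
  have h1 : U s1 t <= re (Q w) - eta by apply: H; rewrite wK.
  have h2 : rabs (Q (w + polar s0 t) - Q w) <= eta / 2.
    apply: hd; rewrite wK; apply: le_lt_trans es0 _; lra.
  have := le_trans (re_rabs _) h2; rewrite reD reN ler_norml -/(U s0 t).
  lra.
rewrite !subr0 => le0 E; move: le0; rewrite E leNgt => /negP; apply.
by rewrite nmulr_rlt0 // oppr_lt0.
Qed.

End Mean.

(** * Maximum principle and Schwarz lemma *)

Section MaxPrinciple.
Variable R : realType.
Local Notation C := (Cplx R).
Implicit Types (Q phi : C -> C) (z w : C).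

(** The closed disc in real coordinates, where it is a closed subset of a square
and hence compact. *)
Definition discR (r : R) : set (R * R) := [set p | rabs (cx p.1 p.2) <= r].

Lemma cx_continuous : continuous (fun p : R * R => cx p.1 p.2 : C).
Proof.
move=> p; apply/cvgrPdist_le => e /cx_gt0P[r r0 ->].
have r2 : 0 < r / 2 by rewrite divr_gt0.
have := nbhsx_ballx p (r / 2) r2; apply: filterS => u [/= q1 q2].
rewrite -rabs_le cxN cxD; apply: le_trans (rabs_cx _ _) _.
by move: q1 q2; rewrite /ball /=; lra.
Qed.

Lemma rabs_cx_continuous : continuous (fun p : R * R => rabs (cx p.1 p.2)).
Proof.
move=> p; rewrite /rabs /=.
apply: (@continuous_comp _ _ _ (fun p : R * R => p.1 ^+ 2 + p.2 ^+ 2) Num.sqrt);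
  last exact: sqrt_continuous.
apply: (@continuousD _ R^o _ (fun p : R * R => p.1 ^+ 2) (fun p => p.2 ^+ 2)).
  apply: (@continuous_comp _ _ _ fst (fun x : R => x ^+ 2)); first exact: cvg_fst.
  exact: exprn_continuous.
apply: (@continuous_comp _ _ _ snd (fun x : R => x ^+ 2)); first exact: cvg_snd.
exact: exprn_continuous.
Qed.

Lemma discR_compact r : compact (discR r).
Proof.
apply: (@subclosed_compact _ _ (`[- r, r]%classic `*` `[- r, r]%classic)).
- have -> : discR r =
    (fun p : R * R => rabs (cx p.1 p.2)) @^-1` [set x | x <= r] by [].
  by apply: closed_comp; [move=> p _; exact: rabs_cx_continuous | exact: closed_le].
- by apply: compact_setX; exact: segment_compact.
- move=> p; rewrite /discR /= => h; rewrite !in_itv /= -!ler_norml; split.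
    by apply: le_trans h; exact: (re_rabs (cx p.1 p.2)).
  by apply: le_trans h; exact: (im_rabs (cx p.1 p.2)).
Qed.

Lemma rcont_disc_continuous (f : C -> R) (p : R * R) :
  (forall e : R, 0 < e -> exists2 d : R, 0 < d &
    forall z, rabs (z - cx p.1 p.2) < d -> `|f z - f (cx p.1 p.2)| <= e) ->
  {for p, continuous (fun q : R * R => f (cx q.1 q.2))}.
Proof.
move=> h; apply/cvgrPdist_le => e e0; have [d d0 hd] := h e e0.
have d2 : 0 < d / 2 by rewrite divr_gt0.
have := nbhsx_ballx p (d / 2) d2; apply: filterS => q [/= q1 q2].
rewrite distrC; apply: hd; rewrite cxN cxD.
apply: le_lt_trans (rabs_cx _ _) _.
by move: q1 q2; rewrite /ball /= !(distrC _ (q.1)) !(distrC _ (q.2)); lra.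
Qed.

Lemma derivable_rcont Q z : derivable Q z 1 -> rcont Q z.
Proof.
move=> /derivable_rabs_estimate[a ha] e e0.
have [d d0 hd] := ha 1 ltr01.
have a1 : 0 < rabs a + 1 by rewrite ltr_wpDl // rabs_ge0.
exists (Num.min d (e / (rabs a + 1))); first by rewrite lt_min d0 divr_gt0.
move=> x; rewrite lt_min => /andP[x1 x2].
have := hd _ x1; rewrite addrCA subrr addr0 => H.
have -> : Q x - Q z = (Q x - Q z - a * (x - z)) + a * (x - z) by rewrite subrK.
apply: le_trans (rabsD _ _) _; rewrite rabsM.
rewrite ltr_pdivlMr // in x2; lra.
Qed.

Lemma rcontM Q w (k : C) : rcont Q w -> rcont (fun z => k * Q z) w.
Proof.
move=> cQ e e0; have k1 : 0 < rabs k + 1 by rewrite ltr_wpDl // rabs_ge0.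
have [d d0 hd] := cQ (e / (rabs k + 1)) (divr_gt0 e0 k1); exists d => // z /hd.
rewrite ler_pdivlMr // -mulrBr rabsM => h.
have := rabs_ge0 (Q z - Q w); lra.
Qed.

Lemma rcontD Q Q' w : rcont Q w -> rcont Q' w -> rcont (fun z => Q z + Q' z) w.
Proof.
move=> cQ cQ' e e0; have e2 : 0 < e / 2 by rewrite divr_gt0.
have [d d0 hd] := cQ _ e2; have [d' d'0 hd'] := cQ' _ e2.
exists (Num.min d d'); first by rewrite lt_min d0.
move=> z; rewrite lt_min => /andP[/hd h1 /hd' h2].
rewrite opprD addrACA; apply: le_trans (rabsD _ _) _; lra.
Qed.

Lemma shift_derivable w z : derivable (fun z : C => z - w) z 1.
Proof.
apply: (@derivableB C C C id (cst w)); first exact: derivable_id.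
exact: derivable_cst.
Qed.

(** A maximum of [rabs Q] exceeding the boundary values is ruled out as usual by
the mean value property, made strict by the perturbation e |z|^2.  Around w one
has |z|^2 = |w|^2 + 2 Re (wb (z - w)) + |z - w|^2 with wb the conjugate of w,
so the perturbation is absorbed in the holomorphic function [Q'] up to a
constant on circles centred at w. *)
Lemma max_principle Q (r B : R) : 0 < r ->
  (forall z, rabs z <= r -> rcont Q z) ->
  (forall z, 0 < rabs z < r -> derivable Q z 1) ->
  (forall z, rabs z = r -> rabs (Q z) <= B) ->
  forall w, rabs w <= r -> rabs (Q w) <= B.
Proof.
move=> r0 cQ dQ bQ w0 w0r; rewrite leNgt; apply/negP => w0B.
pose g := rabs (Q w0) - B; have g0 : 0 < g by rewrite subr_gt0.
have B0 : 0 <= B.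
  apply: le_trans (rabs_ge0 _) (bQ (cx r 0) _).
  by rewrite /rabs re_cx im_cx expr0n addr0 sqrtr_sqr gtr0_norm.
have q0 : 0 < rabs (Q w0) by apply: le_lt_trans w0B.
(* A unimodular constant that turns Q w0 into a positive real number. *)
pose k : C := cx (re (Q w0) / rabs (Q w0)) (- im (Q w0) / rabs (Q w0)).
have kQ : re (k * Q w0) = rabs (Q w0).
  rewrite reM /k re_cx im_cx.
  have -> : re (Q w0) / rabs (Q w0) * re (Q w0) -
    - im (Q w0) / rabs (Q w0) * im (Q w0) =
    (re (Q w0) ^+ 2 + im (Q w0) ^+ 2) / rabs (Q w0) by ring.
  by rewrite -rabs_sqr expr2 mulfK // lt0r_neq0.
have k1 : rabs k = 1.
  apply/eqP; rewrite -(@pexpr_eq1 _ _ 2) ?rabs_ge0 // rabs_sqr /k re_cx im_cx.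
  rewrite !expr_div_n sqrrN -mulrDl -rabs_sqr divff //.
  by rewrite expf_neq0 // lt0r_neq0.
pose e := g / (2 * r ^+ 2).
have r20 : 0 < r ^+ 2 by rewrite exprn_gt0.
have e0 : 0 < e by rewrite divr_gt0 // mulr_gt0.
pose v z := re (k * Q z) + e * rabs z ^+ 2.
have [||p pD pmax] := @compact_EVT_max _ _ (fun p : R * R => v (cx p.1 p.2))
  _ _ (@discR_compact r) _.
- by exists (re w0, im w0); rewrite /discR /= cx_eta.
- apply: continuous_in_subspaceT => p; rewrite inE /discR /= => pr.
  apply: (@continuousD _ R^o _ (fun p : R * R => re (k * Q (cx p.1 p.2)))
            (fun p => e * rabs (cx p.1 p.2) ^+ 2)).
    apply: (@rcont_disc_continuous (fun z => re (k * Q z))) => e' e'0.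
    have [d d0 hd] := rcontM k (cQ _ pr) e'0; exists d => // z /hd h.
    by apply: le_trans h; rewrite -reN -reD; exact: re_rabs.
  apply: continuousM; first exact: cst_continuous.
  apply: (@continuous_comp _ _ _ (fun p : R * R => rabs (cx p.1 p.2))
            (fun x : R => x ^+ 2)); first exact: rabs_cx_continuous.
  exact: exprn_continuous.
move: pD; rewrite inE /discR /=; set w := cx p.1 p.2 => wr.
have {}pmax z : rabs z <= r -> v z <= v w.
  by move=> zr; have := pmax (re z, im z); rewrite inE /discR /= cx_eta; apply.
have wlt : rabs w < r.
  rewrite lt_neqAle wr andbT; apply/eqP => wE.
  have := pmax _ w0r; rewrite /v kQ wE.
  have : re (k * Q w) <= B.
    apply: le_trans (ler_norm _) _; apply: le_trans (re_rabs _) _.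
    by rewrite rabsM k1 mul1r bQ.
  have -> : e * r ^+ 2 = g / 2 by rewrite /e; field; rewrite lt0r_neq0.
  have : 0 <= e * rabs w0 ^+ 2.
    by apply: mulr_ge0; [exact: ltW | rewrite exprn_ge0 // rabs_ge0].
  by move: g0; rewrite /g; lra.
pose wb : C := cx (re w) (- im w).
pose Q' z := k * Q z + 2 * cx e 0 * wb * (z - w).
(* A radius for which the circle around w avoids both the boundary and the
   exceptional point 0, unless w = 0 is the centre. *)
have [rho rho0 [rho1 rho2]] : exists2 rho : R, 0 < rho &
    rho < r - rabs w /\ (w != 0 -> rho < rabs w).
  have rw : 0 < (r - rabs w) / 2 by rewrite divr_gt0 // subr_gt0.
  have [->|wn0] := eqVneq w 0.
    by exists (r / 2); rewrite ?divr_gt0 // rabs0 subr0; split=> //; lra.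
  have w1 : 0 < rabs w by rewrite rabs_gt0.
  exists (Num.min ((r - rabs w) / 2) (rabs w / 2)).
    by rewrite lt_min rw divr_gt0.
  by split=> [|_]; rewrite gt_min; apply/orP; [left|right]; lra.
have er0 : 0 < e * rho ^+ 2 by rewrite mulr_gt0 // exprn_gt0.
have ide (c : C) z : derivable (fun z : C => c * (z - w)) z 1.
  by apply: derivableM; [exact: derivable_cst | exact: shift_derivable].
have [||z zr] := @circle_mean R Q' w rho _ rho0 er0.
- move=> z /andP[z0 z1].
  apply: derivableD; last exact: ide.
  apply: derivableM; first exact: derivable_cst.
  apply: dQ; rewrite rabs_gt0; apply/andP; split.
    apply/eqP => z00; move: z0 z1; rewrite z00 sub0r rabsN rabs_gt0 => /rho2.
    lra.
  by have := rabs_le_dist z w; lra.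
- apply: rcontD; first exact/rcontM/cQ.
  by apply: derivable_rcont; exact: ide.
apply/negP; rewrite -leNgt /Q' subrr mulr0 addr0 reD.
have zr' : rabs z <= r by have := rabs_le_dist z w; lra.
have := pmax _ zr'; rewrite /v.
have : rabs (z - w) ^+ 2 = rho ^+ 2 by rewrite zr.
rewrite !rabs_sqr !(reD, imD, reN, imN) => E.
have -> : re (2 * cx e 0 * wb * (z - w)) =
  2 * e * (re w * (re z - re w) + im w * (im z - im w)).
  rewrite -mulrA -[2 * _ * _]mulrA -[2]/(1 + 1) mulrDl mul1r reD !reM !imM /wb.
  rewrite re_cx im_cx re_cx im_cx !(reD, imD, reN, imN); ring.
rewrite -E => H.
have -> : re (k * Q w) - e * ((re z - re w) ^+ 2 + (im z - im w) ^+ 2) =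
  (re (k * Q w) + e * (re w ^+ 2 + im w ^+ 2)) - e * (re z ^+ 2 + im z ^+ 2)
   + 2 * e * (re w * (re z - re w) + im w * (im z - im w)) by ring.
by lra.
Qed.

(** The difference quotient of phi at 0 extends continuously by the derivative of
phi; the maximum principle applies to it with 0 as the exceptional point. *)
Lemma schwarz phi (r M : R) : 0 < r ->
  (forall z, rabs z <= r -> derivable phi z 1) ->
  (forall z, rabs z <= r -> rabs (phi z) <= M) ->
  forall w, rabs w <= r -> rabs (phi w - phi 0) <= 2 * M / r * rabs w.
Proof.
move=> r0 dphi bphi.
have d0 : derivable phi 0 1 by apply: dphi; rewrite rabs0 ltW.
have [a ha] := derivable_rabs_estimate d0.
pose q z := (phi z - phi 0) * z^-1.
pose Q z := if z == 0 then a else q z.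
have dQ z : z != 0 -> rabs z <= r -> derivable Q z 1.
  move=> z0 zr; apply: (@near_eq_derivable _ _ _ q).
  - have : \forall y \near z, y != 0.
      apply/nbhs_ballP; exists `|z|; first by rewrite /= normr_gt0.
      by move=> y; rewrite /ball /=; apply: contraTneq => ->; rewrite subr0 ltxx.
    by apply: filterS => y /negbTE y0; rewrite /Q y0.
  - apply: derivableM.
      apply: (@derivableB C C C phi (cst (phi 0))); first exact: dphi.
      exact: derivable_cst.
    by apply: (@derivableV C C id); [exact: z0 | exact: derivable_id].
have bQ : forall w, rabs w <= r -> rabs (Q w) <= 2 * M / r.
  apply: max_principle; first exact: r0.
  - move=> z zr; have [->|z0] := eqVneq z 0; last exact/derivable_rcont/dQ.
    move=> e e0; have [d dd0 hd] := ha e e0; exists d => // x.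
    rewrite subr0 /Q eqxx; have [_|x0 xd] := eqVneq x 0.
      by rewrite subrr rabs0 => _; exact: ltW.
    have := hd x xd; rewrite add0r -ler_pdivrMr ?rabs_gt0 //.
    by rewrite -rabsV // -rabsM mulrBl -/(q x) mulfK.
  - by move=> z /andP[z0 zr]; apply: dQ; [rewrite -rabs_gt0 | exact: ltW].
  - move=> z zr; have z0 : z != 0 by rewrite -rabs_gt0 zr.
    rewrite /Q (negbTE z0) rabsM rabsV // zr; apply: ler_wpM2r.
      by rewrite invr_ge0 ltW.
    have h1 := bphi z; have h2 := bphi 0; rewrite zr lexx in h1.
    rewrite rabs0 ltW // in h2.
    have := rabsD (phi z) (- phi 0); rewrite rabsN; have := h1 isT; have := h2 isT.
    lra.
move=> w wr; have [->|w0] := eqVneq w 0; first by rewrite subrr rabs0 mulr0.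
have := bQ w wr; rewrite /Q (negbTE w0) rabsM rabsV // ler_pdivrMr //.
by rewrite rabs_gt0.
Qed.

End MaxPrinciple.

(** * Midpoints under biholomorphic maps *)

Section Midpoint.
Variables (R : realType) (n : nat).
Local Notation C := (Cplx R).
Local Notation V := ('rV[Cplx R]_n).
Implicit Types (x y z u v : V) (F : V -> C).

Definition vle v (r : R) : Prop := forall j, rabs (v ord0 j) <= r.

Lemma vle_trans v r s : r <= s -> vle v r -> vle v s.
Proof. by move=> rs vr j; exact: le_trans (vr j) rs. Qed.

Lemma vleD u v r s : vle u r -> vle v s -> vle (u + v) (r + s).
Proof.
by move=> ur vs j; rewrite mxE; apply: le_trans (rabsD _ _) _; exact: lerD.
Qed.

Lemma vleN v r : vle v r -> vle (- v) r.
Proof. by move=> vr j; rewrite mxE rabsN. Qed.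

Lemma vleZ (k : C) v r : vle v r -> vle (k *: v) (rabs k * r).
Proof.
by move=> vr j; rewrite mxE rabsM; apply: ler_wpM2l (vr j); exact: rabs_ge0.
Qed.

Lemma nbhs_vle z (A : set V) : nbhs z A ->
  exists2 r : R, 0 < r & forall v, vle v r -> A (z + v).
Proof.
move=> /nbhs_ballP[e /= /cx_gt0P[r r0 ->] hA].
exists (r / 2); first by rewrite divr_gt0.
move=> v vr; apply: hA; split; first by rewrite -cx0 cx_lt.
move=> i j; rewrite (ord1 i) /ball /= mxE opprD addrA subrr add0r normrN.
by rewrite -rabs_lt; apply: le_lt_trans (vr j) _; lra.
Qed.

Lemma vle_nbhs z (r : R) : 0 < r -> nbhs z [set z' | vle (z' - z) r].
Proof.
move=> r0; apply/nbhs_ballP; exists (cx r 0); first by rewrite /= -cx0 cx_lt.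
move=> y [_ /= yr] j; have := yr ord0 j.
by rewrite /ball /= !mxE distrC -rabs_lt => /ltW.
Qed.

Lemma differentiable_vle (f : V -> V) z (e : R) : 0 < e -> differentiable f z ->
  exists2 r : R, 0 < r & forall v, vle v r -> vle (f (z + v) - f z) e.
Proof.
move=> e0 df; have cf := differentiable_continuous df.
exact: nbhs_vle (cf _ (vle_nbhs (f z) e0)).
Qed.

Lemma differentiable_entry (f : V -> V) j z : differentiable f z ->
  differentiable (fun z => f z ord0 j : C) z.
Proof.
move=> df; apply: (@differentiable_comp C V V C f (fun N => N ord0 j)).
  exact: df.
exact: differentiable_coord.
Qed.

Lemma line_derivable F z v (t : C) : differentiable F (z + t *: v) ->
  derivable (fun t : C => F (z + t *: v)) t 1.
Proof.
move=> dF; apply/derivable1_diffP.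
apply: (@differentiable_comp C C V C (fun t : C => z + t *: v) F); last exact: dF.
apply: (@differentiableD C C V (cst z) (fun t : C => t *: v)).
  exact: differentiable_cst.
apply: (@differentiableZl C C V id v).
exact: (@derivable1_diffP C C id t).1 (@derivable_id _ _ t 1).
Qed.

(** The Schwarz lemma along the complex line through z in the direction v.  The
case s > r, where the disc is too small, is the trivial bound 2 M. *)
Lemma cauchy_lipschitz F z (r M : R) : 0 < r ->
  (forall u, vle u r -> differentiable F (z + u)) ->
  (forall u, vle u r -> rabs (F (z + u)) <= M) ->
  forall v (s : R), vle v r -> vle v s -> 0 <= s ->
  rabs (F (z + v) - F z) <= 2 * M / r * s.
Proof.
move=> r0 dF bF v s vr vs; rewrite le_eqVlt => /predU1P[s0|s0].
  suff -> : v = 0 by rewrite addr0 subrr rabs0 -s0 mulr0.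
  apply/rowP => j; rewrite mxE; apply/eqP; rewrite -rabs_eq0.
  by rewrite eq_le rabs_ge0 s0 vs.
have z0r : vle (0 : V) r by move=> j; rewrite mxE rabs0 ltW.
have [rs|sr] := ltP r s.
  apply: le_trans (rabsD _ _) _; rewrite rabsN.
  have h1 := bF v vr; have := bF 0 z0r; rewrite addr0 => h2.
  have M0 : 0 <= M := le_trans (rabs_ge0 _) h1.
  apply: le_trans (lerD h1 h2) _.
  rewrite mulrAC ler_pdivlMr //; apply: le_trans (_ : 2 * M * r <= _); first by lra.
  by apply: ler_wpM2l; [rewrite mulr_ge0 | exact: ltW].
pose phi (t : C) := F (z + t *: v).
have small (t : C) : rabs t <= r / s -> vle (t *: v) r.
  move=> ts; apply: vle_trans (vleZ t vs).
  by rewrite -ler_pdivlMr.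
have rs0 : 0 < r / s by rewrite divr_gt0.
have := @schwarz R phi (r / s) M rs0 _ _ 1.
rewrite rabs1 mulr1 /phi scale1r scale0r addr0.
have -> : 2 * M / (r / s) = 2 * M / r * s.
  by field; rewrite !lt0r_neq0.
apply.
- by move=> t /small ts; apply: line_derivable; exact: dF.
- by move=> t /small ts; exact: bF.
- by rewrite ler_pdivlMr // mul1r.
Qed.

(** [cauchy_lipschitz] twice: the increment D x = F (x + v) - F x is holomorphic
and of size O(s), hence its own increment along v is O(s^2). *)
Lemma second_difference F z (r M : R) : 0 < r ->
  (forall u, vle u (2 * r) -> differentiable F (z + u)) ->
  (forall u, vle u (2 * r) -> rabs (F (z + u)) <= M) ->
  forall v (s : R), vle v r -> vle v s -> 0 <= s ->
  rabs (F (z + v + v) - F (z + v) - (F (z + v) - F z)) <= 4 * M / r ^+ 2 * s ^+ 2.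
Proof.
move=> r0 dF bF v s vr vs s0.
pose D x : C := F (x + v) - F x.
have dom u u' : vle u r -> vle u' r -> vle (u + u') (2 * r).
  by move=> ur ur'; have := vleD ur ur'; rewrite -mulr2n mulr_natl.
have dom1 u : vle u r -> vle u (2 * r) by apply: vle_trans; lra.
have shiftd x : differentiable (fun y : V => y + v) x.
  apply: (@differentiableD C V V id (cst v)); last exact: differentiable_cst.
  by case: (is_diff_id x).
have dD u : vle u r -> differentiable D (z + u).
  move=> ur; apply: (@differentiableB C V C (fun x => F (x + v)) F).
    apply: (@differentiable_comp C V V C (fun x => x + v) F).
      exact: shiftd.
    by rewrite -addrA; apply: dF; exact: dom.
  by apply: dF; exact: dom1.
have bD u : vle u r -> rabs (D (z + u)) <= 2 * M / r * s.
  move=> ur; apply: (cauchy_lipschitz r0); [| | exact: vr | exact: vs | exact: s0].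
    by move=> u' ur'; rewrite -addrA; apply: dF; exact: dom.
  by move=> u' ur'; rewrite -addrA; apply: bF; exact: dom.
have := cauchy_lipschitz r0 dD bD vr vs s0.
rewrite /D; have -> // : 2 * (2 * M / r * s) / r * s = 4 * M / r ^+ 2 * s ^+ 2.
by field; rewrite lt0r_neq0.
Qed.

Lemma holomorphic_small (D : set V) (f : V -> V) z (e : R) : 0 < e ->
  open D -> D z -> holomorphic_on D f ->
  exists r M : R, [/\ 0 < r, 0 <= M & forall v, vle v r ->
    [/\ D (z + v), vle (f (z + v) - f z) e & vle (f (z + v)) M]].
Proof.
move=> e0 oD Dz hf.
have [r1 r10 h1] := nbhs_vle (open_nbhs_nbhs (conj oD Dz)).
have [r2 r20 h2] := differentiable_vle e0 (hf _ Dz).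
pose M0 := \sum_(j < n) rabs (f z ord0 j).
have M00 : 0 <= M0 by apply: sumr_ge0 => j _; exact: rabs_ge0.
exists (Num.min r1 r2), (e + M0); split; first by rewrite lt_min r10.
  by rewrite addr_ge0 // ltW.
move=> v vr; have vr1 : vle v r1 by apply: vle_trans vr; rewrite ge_min lexx.
have vr2 : vle v r2 by apply: vle_trans vr; rewrite ge_min lexx orbT.
split; [exact: h1 | exact: h2 |].
have -> : f (z + v) = (f (z + v) - f z) + f z by rewrite subrK.
apply: vleD; first exact: h2.
move=> j; rewrite /M0 (bigD1 j) //= lerDl.
by apply: sumr_ge0 => i _; exact: rabs_ge0.
Qed.

(** Pulling back the midpoint of f (z + v) and f (z + v + 2 w) gives the midpoint
z + v + w up to O(|w|^2): by [second_difference] that midpoint differs from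
f (z + v + w) by a quantity e = O(|w|^2), and g is Lipschitz near f z. *)
Lemma biholomorphic_midpoint (D G : set V) (f g : V -> V) z :
  open D -> open G -> D z -> holomorphic_on D f -> holomorphic_on G g ->
  {homo f : z / D z >-> G z} -> (forall z, D z -> g (f z) = z) ->
  exists2 delta : R, 0 < delta & exists2 K : R, 0 <= K &
    forall v w (s : R), vle v delta -> vle w delta -> vle w s -> 0 <= s ->
    vle (g (2^-1 *: (f (z + v) + f (z + v + w + w))) - (z + v + w)) (K * s ^+ 2).
Proof.
move=> oD oG Dz hf hg fDG gf.
have [r2 [M2 [r20 M20 h2]]] := holomorphic_small ltr01 oG (fDG _ Dz) hg.
have r24 : 0 < r2 / 4 by rewrite divr_gt0.
have [r1 [M1 [r10 M10 h1]]] := holomorphic_small r24 oD Dz hf.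
pose r := r1 / 8; have r0 : 0 < r by rewrite divr_gt0.
have near v : vle v r1 -> D (z + v) by move=> /h1[].
pose K := 2 * M2 / (r2 / 2) * (2 * M1 / r ^+ 2).
have K1 : 0 <= 2 * M1 / r ^+ 2.
  by apply: divr_ge0; [exact: mulr_ge0 | apply/exprn_ge0/ltW].
exists r => //; exists K.
  rewrite mulr_ge0 //; apply: divr_ge0; first exact: mulr_ge0.
  by apply: ltW; rewrite divr_gt0.
move=> v w s vr wr ws s0.
have dom a u : vle a r -> vle u (2 * r) -> vle (a + u) r1.
  by move=> ar ur; apply: vle_trans (vleD ar ur); rewrite /r; lra.
have w2 : vle (w + w) (2 * r) by have := vleD wr wr; rewrite -mulr2n mulr_natl.
have w1 : vle w (2 * r) by apply: vle_trans wr; lra.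
have z2 : vle (0 : V) (2 * r) by move=> j; rewrite mxE rabs0; lra.
have [D0 fd0 _] := h1 _ (dom _ _ vr z2); rewrite !addr0 in D0 fd0.
have [D1 fd1 _] := h1 _ (dom _ _ vr w1); rewrite addrA in D1 fd1.
have [D2 fd2 _] := h1 _ (dom _ _ vr w2); rewrite !addrA in D2 fd2.
pose m := f (z + v + w).
pose e : V := 2^-1 *: (f (z + v) + f (z + v + w + w)) - m.
have half : rabs (2^-1 : C) = 2^-1.
  rewrite rabsV ?pnatr_eq0 //; congr (_^-1).
  rewrite -[2 : C]/(1 + 1 : C) -cx1 cxD /rabs re_cx im_cx addr0 expr0n addr0.
  by rewrite sqrtr_sqr ger0_norm.
have hE : e = 2^-1 *: ((f (z + v + w + w) - m) - (m - f (z + v))).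
  by apply/rowP => j; rewrite !mxE -/m; field.
have eK : vle e (2 * M1 / r ^+ 2 * s ^+ 2).
  move=> j; rewrite hE.
  have -> : 2 * M1 / r ^+ 2 * s ^+ 2 = 2^-1 * (4 * M1 / r ^+ 2 * s ^+ 2).
    by field; rewrite lt0r_neq0.
  rewrite mxE rabsM half; apply: ler_wpM2l => //.
  rewrite !mxE.
  apply: (@second_difference (fun z => f z ord0 j : C));
    [exact: r0 | | | exact: wr | exact: ws | exact: s0] => u ur.
    rewrite -addrA; apply: differentiable_entry; apply: hf; apply: near.
    exact: dom.
  by rewrite -addrA; have [_ _] := h1 _ (dom _ _ vr ur).
have er : vle e (r2 / 2).
  have -> : e = 2^-1 *: ((f (z + v) - f z) + (f (z + v + w + w) - f z))
                - (m - f z).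
    by apply/rowP => j; rewrite !mxE -/m; field.
  have := vleD (vleZ (2^-1) (vleD fd0 fd2)) (vleN fd1).
  by apply: vle_trans; rewrite half; lra.
have gm : g m = z + v + w by rewrite gf.
have -> : 2^-1 *: (f (z + v) + f (z + v + w + w)) = m + e.
  by rewrite [m + e]addrC subrK.
rewrite -gm => j; rewrite !mxE.
have r22 : 0 < r2 / 2 by rewrite divr_gt0.
have md u : vle u (r2 / 2) -> vle (m - f z + u) r2.
  by move=> ur; apply: vle_trans (vleD fd1 ur); lra.
have fz u : m + u = f z + (m - f z + u) by rewrite addrA [f z + _]addrC subrK.
have -> : K * s ^+ 2 = 2 * M2 / (r2 / 2) * (2 * M1 / r ^+ 2 * s ^+ 2).
  by rewrite /K !mulrA.
apply: (@cauchy_lipschitz (fun z => g z ord0 j : C));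
  [exact: r22 | | | exact: er | exact: eK |].
- move=> u ur; apply: differentiable_entry; apply: hg.
  by rewrite fz; have [] := h2 _ (md _ ur).
- by move=> u ur; rewrite fz; have [_ _] := h2 _ (md _ ur).
- by rewrite mulr_ge0 // exprn_ge0.
Qed.

End Midpoint.

(** * Elementary symmetric functions and linear recurrences *)

Section SymmetricFunctions.
Variables (R : realType) (n : nat).
Local Notation C := (Cplx R).
Implicit Types (x z : 'rV[C]_n) (M : nat).

Lemma prod_sub_expand (A : comNzRingType) (a : 'I_n -> A) (u v : A) :
  \prod_j (u - a j * v) =
  u ^+ n + \sum_(k < n) (-1) ^+ k.+1 *
    (\sum_(J : {set 'I_n} | #|J| == k.+1) \prod_(j in J) a j) *
    u ^+ (n - k.+1) * v ^+ k.+1.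
Proof.
pose E (k : nat) := (-1) ^+ k *
    (\sum_(J : {set 'I_n} | #|J| == k) \prod_(j in J) a j) * u ^+ (n - k) * v ^+ k.
have -> : u ^+ n = E 0%N.
  rewrite /E expr0 mul1r subn0 expr0 mulr1.
  rewrite (eq_bigl (pred1 (finset.set0 : {set 'I_n}))) => [|J]; last exact: cards_eq0.
  by rewrite big_pred1_eq big_set0 mul1r.
rewrite -(big_ord_recl n (fun k : 'I_n.+1 => E k)) /=.
under eq_bigr do rewrite addrC.
rewrite bigA_distr.
rewrite (partition_big (fun J : {set 'I_n} => inord #|J| : 'I_n.+1) xpredT) //=.
apply: eq_bigr => k _; rewrite /E mulr_sumr !mulr_suml.
apply: eq_big => [J|J /eqP <-].
  by rewrite -val_eqE /= inordK // ltnS -[X in (_ <= X)%N](card_ord n) max_card.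
rewrite inordK; last by rewrite ltnS -[X in (_ <= X)%N](card_ord n) max_card.
rewrite (bigID (mem J)) /=.
rewrite (eq_bigr (fun i => (-1) * a i * v)) => [|i ->]; last first.
  by rewrite mulN1r mulNr.
rewrite [X in _ * X](eq_bigr (fun=> u)) => [|i /negbTE -> //].
rewrite !big_split /= !prodr_const.
have -> : #|[pred i | i \notin J]| = (n - #|J|)%N.
  have -> : #|[pred i | i \notin J]| = #|[predC J]| by exact: eq_card.
  by have /(canRL (addKn _)) := cardC (mem J); rewrite card_ord.
exact: mulrAC.
Qed.

Definition sym_poly x : {poly C} :=
  'X^n + \sum_(k < n) ((-1) ^+ k.+1 * x ord0 k) *: 'X^(n - k.+1).

Lemma sym_poly_symmetrization z :
  \prod_j ('X - (z ord0 j)%:P) = sym_poly (symmetrization z).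
Proof.
have := prod_sub_expand (fun j => (z ord0 j)%:P) 'X 1.
under eq_bigr do rewrite mulr1.
move=> ->; congr (_ + _); apply: eq_bigr => k _.
rewrite expr1n mulr1 mxE -mul_polyC polyCM rmorphXn rmorphN1; congr (_ * _ * _).
by rewrite rmorph_sum; apply: eq_bigr => J _; rewrite rmorph_prod.
Qed.

Lemma horner_sym_poly x (t : C) : (sym_poly x).[t] =
  t ^+ n + \sum_(k < n) (-1) ^+ k.+1 * x ord0 k * t ^+ (n - k.+1).
Proof.
rewrite hornerD hornerXn horner_sum; congr (_ + _); apply: eq_bigr => k _.
by rewrite hornerZ hornerXn.
Qed.

Lemma coef_sym_poly x (k : 'I_n) :
  (sym_poly x)`_(n - k.+1) = (-1) ^+ k.+1 * x ord0 k.
Proof.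
have kn := ltn_ord k.
rewrite coefD coefXn coef_sum (bigD1 k) //= coefZ coefXn eqxx mulr1.
rewrite big1 => [|i ik]; last first.
  rewrite coefZ coefXn; case: eqP => [e|]; last by rewrite mulr0.
  case/eqP: ik; apply: val_inj => /=; have := ltn_ord i; lia.
by case: eqP => [|_]; [lia | rewrite add0r addr0].
Qed.

Lemma size_sym_poly x : size (sym_poly x) = n.+1.
Proof.
rewrite /sym_poly size_polyDl size_polyXn // ltnS.
apply: (leq_trans (size_sum _ _ _)); apply/bigmax_leqP => k _.
apply: (leq_trans (size_scale_leq _ _)); rewrite size_polyXn.
by have := ltn_ord k; lia.
Qed.

Lemma monic_sym_poly x : sym_poly x \is monic.
Proof.
rewrite monicE lead_coefE size_sym_poly /= coefD coefXn eqxx coef_sum.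
rewrite big1 ?addr0 // => k _; rewrite coefZ coefXn.
case: eqP => [|_]; last by rewrite mulr0.
by have := ltn_ord k; lia.
Qed.

Lemma sym_poly_inj x y : sym_poly x = sym_poly y -> x = y.
Proof.
move=> xy; apply/rowP => k; have := coef_sym_poly y k.
rewrite -xy coef_sym_poly => /(mulfI _); apply.
by rewrite expf_neq0 // oppr_eq0 oner_eq0.
Qed.

Lemma symmetrized_polydisc_of_roots x :
  (forall t, root (sym_poly x) t -> `|t| < 1) -> symmetrized_polydisc x.
Proof.
move=> rx.
have [r Er] := closed_field_poly_normal (sym_poly x).
have := monic_sym_poly x; rewrite monicE => /eqP lx; rewrite lx scale1r in Er.
have sr : size r = n.
  by have := size_sym_poly x; rewrite Er size_prod_XsubC => -[].
exists (\row_j r`_j) => [j|].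
  rewrite mxE; apply: rx; rewrite Er root_prod_XsubC mem_nth // sr; exact: ltn_ord.
apply: sym_poly_inj; rewrite -sym_poly_symmetrization Er.
by rewrite (big_nth 0) big_mkord sr; apply: eq_bigr => j _; rewrite mxE.
Qed.

(** Consider the sequence s with s_N = 1 for N <= 0 and
s_N = x_1 s_(N-1) - x_2 s_(N-2) + ... for N >= 1; then [linrec x M j] is
s_(M-j), the past of the sequence as seen from time M. *)
Fixpoint linrec x (M j : nat) : C :=
  match M, j with
  | 0%N, _ => 1
  | M'.+1, 0%N => \sum_(k < n) (-1) ^+ k * x ord0 k * linrec x M' k
  | M'.+1, j'.+1 => linrec x M' j'
  end.

(** The polynomial p, read as a polynomial in the backward shift, applied to the
sequence and evaluated at time M. *)
Definition act x M (p : {poly C}) : C := \sum_(k < size p) p`_k * linrec x M k.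

Lemma act_widen x M (p : {poly C}) N : (size p <= N)%N ->
  act x M p = \sum_(k < N) p`_k * linrec x M k.
Proof.
move=> pN; rewrite /act (big_ord_widen _ (fun k => p`_k * linrec x M k) pN).
rewrite big_mkcond; apply: eq_bigr => k _; case: ltnP => // /(nth_default 0) ->.
by rewrite mul0r.
Qed.

Lemma act_mulX x M (c : C) (p : {poly C}) :
  act x M.+1 (p * (1 - c *: 'X)) = act x M.+1 p - c * act x M p.
Proof.
pose N := (size p).+2.
have s1 : (size (p * (1 - c *: 'X))%R <= N)%N.
  apply: leq_trans (size_mul_leq _ _) _.
  have : (size (1 - c *: 'X)%R <= 2)%N.
    apply: leq_trans (size_polyD _ _) _; rewrite size_poly1 size_polyN geq_max /=.
    by apply: leq_trans (size_scale_leq _ _) _; rewrite size_polyX.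
  set q := (1 - _); rewrite /N => h; rewrite -(leq_add2l (size p)) in h.
  by apply: leq_trans (leq_pred _) _; rewrite -addn2.
rewrite (@act_widen x M.+1 _ N s1) (@act_widen x M.+1 p N) 1?leqW //.
rewrite (@act_widen x M p (size p).+1) // big_ord_recl [X in _ = X - _]big_ord_recl.
rewrite [c * _]mulr_sumr -addrA -sumrB.
have E k : (p * (1 - c *: 'X))`_k =
    p`_k - c * (if k is k'.+1 then p`_k' else 0).
  by rewrite mulrBr mulr1 coefB -scalerAr coefZ coefMX; case: k.
rewrite E mulr0 subr0; congr (_ + _); apply: eq_bigr => k _.
by rewrite E /= mulrBl mulrA.
Qed.

Lemma act1 x M : act x M 1 = linrec x M 0.
Proof.
by rewrite (@act_widen x M 1 1) ?size_poly1 // big_ord1 coef1 mul1r.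
Qed.

Lemma act0 x p : act x 0 p = p.[1].
Proof. by rewrite horner_coef; apply: eq_bigr => k _; rewrite expr1n. Qed.

Definition rev_prod (s : seq C) : {poly C} := \prod_(r <- s) (1 - r *: 'X).

(** Removing one factor 1 - r X, |r| <= 1, amounts to solving the recurrence
u_(M+1) = v_(M+1) + r u_M, which costs at most one power of M. *)
Lemma act_bound_step x (r : C) s (A : C) m : `|r| <= 1 -> 0 <= A ->
  `|act x 0 (rev_prod s)| <= A ->
  (forall M, `|act x M (rev_prod (r :: s))| <= A * M.+1%:R ^+ m) ->
  forall M, `|act x M (rev_prod s)| <= A * M.+1%:R ^+ m.+1.
Proof.
move=> r1 A0 h0 h; elim=> [|M IH]; first by rewrite expr1n mulr1.
have := h M.+1; rewrite /rev_prod big_cons mulrC act_mulX -/(rev_prod s) => hM.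
have -> : act x M.+1 (rev_prod s) =
    (act x M.+1 (rev_prod s) - r * act x M (rev_prod s))
    + r * act x M (rev_prod s) by rewrite subrK.
apply: le_trans (ler_normD _ _) _; rewrite normrM.
have h2 : `|r| * `|act x M (rev_prod s)| <= 1 * (A * M.+1%:R ^+ m.+1).
  by apply: ler_pM.
apply: le_trans (lerD hM h2) _; rewrite mul1r -mulrDr; apply: ler_wpM2l => //.
have -> : M.+2%:R ^+ m.+1 = M.+2%:R ^+ m + M.+1%:R * M.+2%:R ^+ m :> C.
  by rewrite exprS -[M.+2]add1n natrD mulrDl mul1r.
rewrite lerD2l exprS.
apply: ler_wpM2l; first exact: ler0n.
by apply: lerXn2r; rewrite ?nnegrE ?ler0n // ler_nat.
Qed.

(** The product of the 1 - z_j X is the characteristic polynomial of the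
recurrence, so it annihilates the sequence from time 1 on. *)
Lemma act_prod_root z M :
  act (symmetrization z) M.+1 (rev_prod [seq z ord0 j | j : 'I_n]) = 0.
Proof.
set x := symmetrization z.
have -> : rev_prod [seq z ord0 j | j : 'I_n] =
    1 + \sum_(k < n) ((-1) ^+ k.+1 * x ord0 k) *: 'X^(k.+1).
  rewrite /rev_prod big_map big_enum /=.
  have := prod_sub_expand (fun j => (z ord0 j)%:P) 1 'X.
  under eq_bigr do rewrite mul_polyC.
  move=> ->; rewrite expr1n; congr (_ + _); apply: eq_bigr => k _.
  rewrite expr1n mulr1 mxE -mul_polyC polyCM rmorphXn rmorphN1; congr (_ * _ * _).
  by rewrite rmorph_sum; apply: eq_bigr => J _; rewrite rmorph_prod.
have sz : (size (1 + \sum_(k < n) ((-1) ^+ k.+1 * x ord0 k) *: 'X^(k.+1))%R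
           <= n.+1)%N.
  apply: leq_trans (size_polyD _ _) _; rewrite size_poly1 geq_max /=.
  apply: (leq_trans (size_sum _ _ _)); apply/bigmax_leqP => k _.
  by apply: (leq_trans (size_scale_leq _ _)); rewrite size_polyXn ltnS.
rewrite (@act_widen x M.+1 _ n.+1 sz) big_ord_recl /= coefD coef1 coef_sum.
rewrite big1 => [|k _]; last first.
  by rewrite coefZ coefXn mulr0.
rewrite addr0 mul1r -big_split /= big1 // => k _.
rewrite coefD coef1 add0r coef_sum (bigD1 k) //= coefZ coefXn eqxx mulr1.
rewrite big1 => [|i ik]; last first.
  rewrite coefZ coefXn eqSS; case: eqP => [e|]; last by rewrite mulr0.
  by case/eqP: ik; apply: val_inj.
by rewrite addr0 exprS mulN1r mulNr mulNr -mulrA subrr.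
Qed.

(** The product of all factors annihilates the sequence, and the n factors are
removed one at a time; at time 0 the sequence is constant and each partial
product is at most 2^n. *)
Lemma linrec_bound x M : symmetrized_polydisc x ->
  `|linrec x M 0| <= 2 ^+ n * M.+1%:R ^+ n.
Proof.
move=> [z z1 <-]; set s := [seq z ord0 j | j : 'I_n].
have z1' r : r \in s -> `|r| <= 1 by move=> /mapP[j _ ->]; exact/ltW/z1.
have ss : size s = n by rewrite size_map size_enum_ord.
have b0 t t' : s = t ++ t' -> `|act (symmetrization z) 0 (rev_prod t')| <= 2 ^+ n.
  move=> st; rewrite act0 /rev_prod horner_prod normr_prod.
  apply: le_trans (_ : \prod_(r <- t') (2 : C) <= _); last first.
    rewrite big_const_seq count_predT iter_mulr_1.
    apply: ler_weXn2l; first by rewrite ler1n.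
    by rewrite -ss st size_cat leq_addl.
  rewrite big_seq [leRHS]big_seq; apply: ler_prod => r rt; rewrite normr_ge0 /=.
  rewrite hornerD hornerN hornerZ hornerX hornerC mulr1.
  apply: le_trans (ler_normB _ _) _; rewrite normr1 -[2]/(1 + 1).
  by apply: lerD => //; apply: z1'; rewrite st mem_cat rt orbT.
suff H t t' : s = t ++ t' -> forall M, `|act (symmetrization z) M (rev_prod t')|
     <= 2 ^+ n * M.+1%:R ^+ size t.
  have := H s [::]; rewrite cats0 => /(_ erefl M).
  by rewrite /rev_prod big_nil act1 ss.
elim/last_ind: t t' => [|t r IH] t' st.
  move=> [|M']; rewrite expr0 mulr1; first exact: (b0 [::]).
  rewrite -[t']/([::] ++ t') -st act_prod_root normr0.
  by apply: exprn_ge0; exact: ler0n.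
rewrite size_rcons; apply: (@act_bound_step _ r).
- by apply: z1'; rewrite st mem_cat mem_rcons inE eqxx.
- by apply: exprn_ge0; exact: ler0n.
- exact: b0 st.
- by apply: IH; rewrite st cat_rcons.
Qed.

End SymmetricFunctions.

(** * Stable trinomials *)

Section StableTrinomials.
Variable R : realType.
Local Notation C := (Cplx R).
Implicit Types (w z q a b c v : C).

(** Used with the values q = P(w) and q' = P*(w) at a point |w| >= 1 of a
polynomial P and of its reversed conjugate P*; that P* is dominated by P
outside of the open disc, without common zeros, expresses that all roots of P
lie in the open disc. *)
Definition dominates (q q' : C) : Prop := q != 0 /\ rabs q' <= rabs q.

(** The Schur-Cohn step: with P also the polynomial w P + b P*, |b| < 1, has all
its roots in the open disc, since
|w P + b P*|^2 - |P* + cj b w P|^2 = (1 - |b|^2) (|w P|^2 - |P*|^2). *)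
Lemma schur_step w q (q' : C) b : 1 <= rabs w -> rabs b < 1 -> dominates q q' ->
  dominates (w * q + b * q') (q' + cj b * (w * q)).
Proof.
move=> w1 b1 [q0 qq']; set P := w * q.
have q0' : 0 < rabs q by rewrite rabs_gt0.
have Pq : rabs q <= rabs P.
  by rewrite /P rabsM; apply: ler_peMl => //; exact: rabs_ge0.
have P0 := lt_le_trans q0' Pq.
have Pq' := le_trans qq' Pq.
split.
  apply/negP => /eqP E.
  have : rabs P = rabs b * rabs q'.
    rewrite -rabsM -rabsN; congr rabs; apply/eqP.
    by rewrite eqr_oppLR -addr_eq0 E.
  have : rabs b * rabs q' <= rabs b * rabs P.
    by apply: ler_wpM2l => //; exact: rabs_ge0.
  have : rabs b * rabs P < 1 * rabs P by rewrite ltr_pM2r.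
  lra.
rewrite -(@ler_pXn2r _ 2) ?nnegrE ?rabs_ge0 //.
rewrite -subr_ge0 !rabs_sqr.
have -> : re (P + b * q') ^+ 2 + im (P + b * q') ^+ 2 -
   (re (q' + cj b * P) ^+ 2 + im (q' + cj b * P) ^+ 2) =
   (1 - rabs b ^+ 2) * (rabs P ^+ 2 - rabs q' ^+ 2).
  by rewrite !rabs_sqr !(reD, imD, reM, imM) !re_cx !im_cx; ring.
apply: mulr_ge0; rewrite subr_ge0.
  by rewrite expr_le1 ?rabs_ge0 // ltW.
by rewrite ler_pXn2r ?nnegrE ?rabs_ge0.
Qed.

Lemma dominates_linear w (c : C) : 1 <= rabs w -> rabs c < 1 ->
  dominates (w + c) (1 + cj c * w).
Proof.
move=> w1 c1; have one : dominates 1 1 by split; [exact: oner_neq0 | exact: lexx].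
by have := schur_step w1 c1 one; rewrite !mulr1.
Qed.

Definition stable_trinomial (d : nat) a b : Prop :=
  forall w, 1 <= rabs w -> w ^+ d.+1 + a * w + b != 0.

Lemma stable_cj d a b : stable_trinomial d a b ->
  stable_trinomial d (cj a) (cj b).
Proof.
move=> st w w1; have := st (cj w); rewrite rabs_cj => /(_ w1).
apply: contraNneq => E.
by rewrite -[X in _ + X]cjK -[a]cjK -cjM -cj_exp -!cjD E cj0.
Qed.

(** Two Schur-Cohn steps from w + v, with parameters c and b; the hypothesis says
that the coefficient of w^2 of the resulting cubic vanishes. *)
Lemma stable_cubic_schur b c v : rabs b < 1 -> rabs c < 1 -> rabs v < 1 ->
  v + c * cj v + b * cj c = 0 ->
  stable_trinomial 2 (c + b * cj (v + c * cj v)) b.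
Proof.
move=> b1 c1 v1 e2 w w1.
have [+ _] := schur_step w1 b1 (schur_step w1 c1 (dominates_linear w1 v1)).
apply: contraNneq => E; rewrite -E cjD cjM cjK; apply/eqP.
transitivity (w ^+ 3 + (v + c * cj v + b * cj c) * w ^+ 2 +
   (c + b * (cj v + cj c * v)) * w + b); first by ring.
by rewrite e2 mul0r addr0.
Qed.

(** Three Schur-Cohn steps from w + u, with parameters v, c and b; the hypotheses
say that the coefficients of w^3 and w^2 of the resulting quartic vanish. *)
Lemma stable_quartic_schur b c v (u : C) :
  rabs b < 1 -> rabs c < 1 -> rabs v < 1 -> rabs u < 1 ->
  u + v * cj u + c * cj v + b * cj c = 0 ->
  v + c * cj (u + v * cj u) + b * (cj v + cj c * (u + v * cj u)) = 0 ->
  stable_trinomial 3 (c + b * (cj (u + v * cj u) + cj c * v)) b.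
Proof.
move=> b1 c1 v1 u1 e3 e2 w w1.
have [+ _] := schur_step w1 b1 (schur_step w1 c1 (schur_step w1 v1
  (dominates_linear w1 u1))).
apply: contraNneq => E; rewrite -E; move: e3 e2; rewrite cjD cjM cjK => e3 e2.
apply/eqP; transitivity (w ^+ 4 + (u + v * cj u + c * cj v + b * cj c) * w ^+ 3 +
   (v + c * (cj u + cj v * u) + b * (cj v + cj c * (u + v * cj u))) * w ^+ 2 +
   (c + b * (cj u + cj v * u + cj c * v)) * w + b); first by ring.
by rewrite e3 e2 !mul0r !addr0.
Qed.

(** The parameters b and c are Gaussian rationals for which 1 + Re a + Re b is
negative (here -1/343, and -1/1936 in [stable_quartic]); the remaining Schur
parameters are then determined by the vanishing coefficients. *)
Lemma stable_cubic : stable_trinomial 2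
  (cx (- (246 / 343)) (- (123 / 343))) (cx (- (2 / 7)) (2 / 7)).
Proof.
pose b : C := cx (- (2 / 7)) (2 / 7); pose c : C := cx (- (6 / 7)) (- (3 / 7)).
pose v : C := cx (- (6 / 7)) 0.
have -> : cx (- (246 / 343)) (- (123 / 343)) = c + b * cj (v + c * cj v).
  by rewrite /cj /b /c /v !(re_cx, im_cx, cxM, cxD); congr cx; lra.
apply: stable_cubic_schur; try by apply: rabs_lt1; rewrite re_cx im_cx; lra.
by rewrite /cj /b /c /v !(re_cx, im_cx, cxM, cxD) -cx0; congr cx; lra.
Qed.

Lemma stable_quartic : stable_trinomial 3
  (cx (- (1233 / 1936)) (- (411 / 1936))) (cx (- (8 / 22)) (3 / 22)).
Proof.
pose b : C := cx (- (8 / 22)) (3 / 22); pose c : C := cx (- (3 / 4)) (- (1 / 4)).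
pose v : C := cx (- (23 / 66)) (- (36 / 66)).
pose u : C := cx (- (2514 / 2531)) (- (50 / 2531)).
have -> : cx (- (1233 / 1936)) (- (411 / 1936)) =
    c + b * (cj (u + v * cj u) + cj c * v).
  by rewrite /cj /b /c /v /u !(re_cx, im_cx, cxM, cxD); congr cx; lra.
apply: stable_quartic_schur; try by apply: rabs_lt1; rewrite re_cx im_cx; lra.
  by rewrite /cj /b /c /v /u !(re_cx, im_cx, cxM, cxD) -cx0; congr cx; lra.
by rewrite /cj /b /c /v /u !(re_cx, im_cx, cxM, cxD) -cx0; congr cx; lra.
Qed.

End StableTrinomials.

(** * The weighted slice of the symmetrized polydisc *)

Section Trinomials.
Variables (R : realType) (n : nat).
Local Notation C := (Cplx R).
Local Notation V := ('rV[Cplx R]_n).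
Implicit Types (x : V) (a b t : C).

Definition wscale t x : V := \row_j (t ^+ j.+1 * x ord0 j).

Lemma symmetrized_polydisc_wscale t x : rabs t <= 1 ->
  symmetrized_polydisc x -> symmetrized_polydisc (wscale t x).
Proof.
move=> t1 [z z1 <-]; exists (t *: z) => [j|].
  rewrite mxE normrM; apply: le_lt_trans (z1 j).
  by rewrite ler_piMl // -cx1 -rabs_le.
apply/rowP => k; rewrite !mxE mulr_sumr; apply: eq_bigr => J /eqP <-.
by under eq_bigr do rewrite mxE; rewrite big_split prodr_const.
Qed.

(** The sign makes [tri p q a b] the point of coefficients of
z^n + a z^(n-p) + b z^(n-q), see [horner_tri]. *)
Definition slot (p : nat) : V := \row_j (if j.+1 == p then (-1) ^+ p else 0).
Definition tri p q a b : V := a *: slot p + b *: slot q.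

Lemma wscale_tri p q a b t :
  wscale t (tri p q a b) = tri p q (t ^+ p * a) (t ^+ q * b).
Proof.
apply/rowP => j; rewrite !mxE; case: eqP => [<-|_]; case: eqP => [<-|_];
  by rewrite ?mulr0 ?addr0 ?add0r ?mulr0 ?mulrDr ?mulrA.
Qed.

Lemma sum_slot p (F : nat -> C) : (0 < p <= n)%N ->
  \sum_(k < n) (-1) ^+ k.+1 * slot p ord0 k * F k = F p.-1.
Proof.
case: p => // p /= pn; rewrite (bigD1 (Ordinal pn)) //= mxE eqxx -expr2 -exprM.
rewrite mulnC exprM sqrrN !expr1n mul1r big1 ?addr0 // => k kp.
rewrite mxE eqSS; case: eqP => [e|_]; last by rewrite mulr0 mul0r.
by case/eqP: kp; apply: val_inj.
Qed.

Lemma sum_tri p q a b (F : nat -> C) : (0 < p <= n)%N -> (0 < q <= n)%N ->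
  \sum_(k < n) (-1) ^+ k.+1 * tri p q a b ord0 k * F k = a * F p.-1 + b * F q.-1.
Proof.
move=> hp hq; rewrite -(sum_slot F hp) -(sum_slot F hq) !mulr_sumr -big_split /=.
apply: eq_bigr => k _.
have -> : tri p q a b ord0 k = a * slot p ord0 k + b * slot q ord0 k.
  by rewrite !mxE.
by ring.
Qed.

Lemma horner_tri p q a b t : (0 < p <= n)%N -> (0 < q <= n)%N ->
  (sym_poly (tri p q a b)).[t] = t ^+ n + a * t ^+ (n - p) + b * t ^+ (n - q).
Proof.
move=> hp hq; rewrite horner_sym_poly (sum_tri _ _ (fun k => t ^+ (n - k.+1))) //.
by case/andP: hp => p0 _; case/andP: hq => q0 _; rewrite !prednK // addrA.
Qed.

(** z^n + a z^(n-dk) + b z^(n-(d+1)k) is z^(n-(d+1)k) times the trinomial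
w^(d+1) + a w + b at w = z^k. *)
Lemma stable_tri_mem d k a b : (0 < d)%N -> (0 < k)%N -> (d.+1 * k <= n)%N ->
  stable_trinomial d a b -> symmetrized_polydisc (tri (d * k) (d.+1 * k) a b).
Proof.
move=> d0 k0 dk st; apply: symmetrized_polydisc_of_roots => t; rewrite /root.
have hdk : (d * k <= d.+1 * k)%N by rewrite leq_mul2r leqnSn orbT.
rewrite horner_tri ?muln_gt0 ?d0 ?k0 ?(leq_trans hdk) //.
apply: contraTT; rewrite -cx1 -rabs_lt -leNgt => t1.
have e1 : t ^+ n = t ^+ (n - d.+1 * k) * (t ^+ k) ^+ d.+1.
  by rewrite -exprM -exprD mulnC subnK // mulnC.
have e2 : t ^+ (n - d * k) = t ^+ (n - d.+1 * k) * t ^+ k.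
  by rewrite -exprD; congr (_ ^+ _); rewrite mulSn in dk *; lia.
rewrite e1 e2 mulrCA [b * _]mulrC -!mulrDr mulf_neq0 //.
  by rewrite expf_neq0 // -rabs_gt0 (lt_le_trans ltr01).
by apply: st; rewrite rabsX exprn_ege1.
Qed.

(** Here the recurrence reads s_N = A s_(N-p) + B s_(N-q): over n consecutive steps
a lower bound is multiplied by A + B.  The exponent is the ceiling of
(M - j) / n, or 0 if j >= M. *)
Lemma tri_linrec_lower p q (A B : R) : (0 < p <= n)%N -> (0 < q <= n)%N ->
  0 <= A -> 0 <= B -> 1 < A + B ->
  forall M j, (j < n)%N ->
  cx ((A + B) ^+ ((M + n.-1 - j) %/ n)) 0
    <= linrec (tri p q (cx (- A) 0) (cx (- B) 0)) M j.
Proof.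
move=> hp hq A0 B0 AB; elim=> [|M IH] [|j] jn.
- by rewrite add0n subn0 divn_small ?prednK // expr0 /= -cx1.
- rewrite add0n divn_small; last by move: jn; lia.
  by rewrite expr0 /= -cx1.
- set c := tri _ _ _ _.
  have -> : linrec c M.+1 0 = cx A 0 * linrec c M p.-1 + cx B 0 * linrec c M q.-1.
    rewrite /=; under eq_bigr => k _.
      rewrite (_ : _ * _ * _ = - ((-1) ^+ k.+1 * c ord0 k * linrec c M k)); last first.
        by rewrite exprS mulN1r !mulNr opprK.
      over.
    rewrite sumrN (sum_tri _ _ (fun k => linrec c M k)) //.
    by rewrite opprD -!mulNr !cxN !opprK oppr0.
  have n0 : (0 < n)%N by lia.
  have -> : ((M.+1 + n.-1 - 0) %/ n = (M %/ n).+1)%N.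
    by rewrite subn0 addSnnS prednK // divnDr ?dvdnn // divnn n0 addn1.
  rewrite exprS mulrDl.
  have mono r : (0 < r <= n)%N ->
     cx ((A + B) ^+ (M %/ n)) 0 <= linrec c M r.-1.
    move=> /andP[r0 rn]; apply: le_trans (IH _ _); last by lia.
    rewrite cx_le; apply: ler_weXn2l; first exact: ltW.
    by apply: leq_div2r; lia.
  set T := (A + B) ^+ _ in mono *.
  have -> : cx (A * T + B * T) 0 = cx A 0 * cx T 0 + cx B 0 * cx T 0.
    by rewrite !cxM !cxD; congr cx; ring.
  by apply: lerD; (apply: ler_wpM2l; [rewrite -cx0 cx_le | exact: mono]).
- by rewrite /= addSn subSS; apply: IH; exact: ltnW.
Qed.

(** Along an arbitrary map h, to serve both for the identity (continuity in the
point) and for holomorphic curves. *)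
Lemma linrec_differentiable (W : normedModType C) (h : W -> V) w :
  (forall k, differentiable (fun w => h w ord0 k : C) w) ->
  forall M j, differentiable (fun w => linrec (h w) M j : C) w.
Proof.
move=> dh; elim=> [|M IH] j /=; first exact: differentiable_cst.
case: j => [|j]; last exact: IH.
have -> : (fun w =>
     \sum_(k < n) (-1) ^+ k * h w ord0 k * linrec (h w) M k : C) =
   \sum_(k < n) (fun w => (-1) ^+ k * h w ord0 k * linrec (h w) M k : C).
  by apply/funext => u; rewrite fct_sumE.
apply: differentiable_sum => k.
apply: (@differentiableM C W (fun w => (-1) ^+ k * h w ord0 k)
  (fun w => linrec (h w) M k)); last exact: IH.
apply: (@differentiableM C W (cst ((-1) ^+ k)) (fun w => h w ord0 k)).
  exact: differentiable_cst.
exact: dh.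
Qed.

Lemma linrec_cont x M j (e : R) : 0 < e -> exists2 d : R, 0 < d &
  forall y, vle (y - x) d -> rabs (linrec y M j - linrec x M j) <= e.
Proof.
move=> e0.
have dL : differentiable (fun y : V => linrec y M j : C) x.
  by apply: linrec_differentiable => k; exact: differentiable_coord.
have cL := differentiable_continuous dL.
have nb : nbhs (linrec x M j : C) [set u | rabs (u - linrec x M j) <= e].
  apply/nbhs_ballP; exists (cx e 0); first by rewrite /= -cx0 cx_lt.
  by move=> u; rewrite /ball /= distrC -rabs_lt => /ltW.
have [d d0 hd] := nbhs_vle (cL _ nb).
by exists d => // y /hd /=; rewrite [x + _]addrC subrK.
Qed.

End Trinomials.

(** Bernoulli's inequality gives tau^K >= K d with d = tau - 1; the power of
exponent n + 1 of this beats any polynomial of degree n in K. *)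
Lemma exp_beats_poly (R : realType) (tau A : R) (n : nat) : 1 < tau ->
  exists L, A * ((n * L).+1)%:R ^+ n < tau ^+ L.
Proof.
move=> t1; wlog A0 : A / 0 < A => [H|].
  have [L hL] := H (`|A| + 1) (ltr_wpDl (normr_ge0 _) ltr01); exists L.
  apply: le_lt_trans hL; apply: ler_wpM2r; first by rewrite exprn_ge0 ?ler0n.
  by apply: le_trans (ler_norm _) _; rewrite lerDl.
pose d := tau - 1; have d0 : 0 < d by rewrite subr_gt0.
pose B := A * (n.+1 ^ 2)%:R ^+ n / d ^+ n.+1.
pose K := (Num.truncn B).+1; have BK : B < K%:R by exact: truncnS_gt.
have K1 : (1 <= K)%N by [].
exists (K * n.+1)%N.
have bern k : 1 + k%:R * d <= tau ^+ k.
  elim: k => [|k IH]; first by rewrite mul0r addr0 expr0.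
  have e1 : 1 <= tau ^+ k by apply: exprn_ege1; exact: ltW.
  have step : d * 1 <= d * tau ^+ k by apply: ler_wpM2l => //; exact: ltW.
  have -> : tau ^+ k.+1 = tau ^+ k + d * tau ^+ k.
    by rewrite exprS /d mulrBl mul1r addrC subrK.
  by rewrite -natr1 mulrDl mul1r; lra.
rewrite exprM; apply: lt_le_trans (_ : (K%:R * d) ^+ n.+1 <= _); last first.
  apply: lerXn2r; rewrite ?nnegrE ?mulr_ge0 ?ler0n ?exprn_ge0 //; try lra.
  by apply: le_trans (bern K); rewrite lerDr.
apply: le_lt_trans (_ : A * ((n.+1 ^ 2)%:R * K%:R) ^+ n < _).
  apply: ler_wpM2l; first exact: ltW.
  by apply: lerXn2r; rewrite ?nnegrE ?mulr_ge0 ?ler0n // -natrM ler_nat; nia.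
have dn0 : 0 < d ^+ n.+1 by rewrite exprn_gt0.
rewrite !exprMn mulrA [ltRHS]mulrC [K%:R ^+ n.+1]exprS mulrA.
have Kn : 0 < K%:R ^+ n :> R by rewrite exprn_gt0 // ltr0n.
by rewrite ltr_pM2r // mulrC -ltr_pdivrMr.
Qed.

Section Main.
Variables (R : realType) (n : nat).
Local Notation C := (Cplx R).
Local Notation V := ('rV[Cplx R]_n).

Lemma tri_curve_differentiable p q (a b t : C) :
  differentiable (fun t : C => tri n p q (t ^+ p * a) (t ^+ q * b)) t.
Proof.
have pw k (c : C) : differentiable (fun t : C => t ^+ k * c : C) t.
  apply: (@differentiableM C C (fun t : C => t ^+ k) (cst c)).
    apply: (@derivable1_diffP C C (fun t : C => t ^+ k) t).1.
    exact: exprn_derivable.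
  exact: differentiable_cst.
apply: (@differentiableD C C V (fun t : C => (t ^+ p * a) *: slot R n p)
  (fun t : C => (t ^+ q * b) *: slot R n q)).
  by apply: (@differentiableZl C C V (fun t : C => t ^+ p * a : C)); exact: pw.
by apply: (@differentiableZl C C V (fun t : C => t ^+ q * b : C)); exact: pw.
Qed.

Lemma convex_midpoint (G : set V) (x y : V) :
  convex_set (G : set (convex_lmodType V)) -> G x -> G y ->
  G (2^-1 *: (x + y)).
Proof.
move=> cG Gx Gy.
have h0 : (0 : C) <= 2^-1 by rewrite invr_ge0 ler0n.
have h1 : (2^-1 : C) <= 1 by rewrite (@invf_le1 C) ?ltr0n // ler1n.
have := cG x y (Itv01 h0 h1); rewrite !inE => /(_ Gx Gy).
rewrite /conv /= scalerDr.
by have -> : unstable.onem (2^-1 : C) = 2^-1 by rewrite /unstable.onem; field.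
Qed.

Lemma slice_disc_compact p q (a b : C) :
  compact [set tri n p q (t ^+ p * a) (t ^+ q * b) |
             t in [set t : C | rabs t <= 1]].
Proof.
pose F (u : R * R) : V := tri n p q (cx u.1 u.2 ^+ p * a) (cx u.1 u.2 ^+ q * b).
have -> : [set tri n p q (t ^+ p * a) (t ^+ q * b) |
             t in [set t : C | rabs t <= 1]] = F @` discR 1.
  apply/seteqP; split => [_ [t t1 <-]|_ [u u1 <-]].
    by exists (re t, im t); rewrite /discR /F /= cx_eta.
  by exists (cx u.1 u.2).
apply: continuous_compact; last exact: discR_compact.
apply: continuous_subspaceT => u.
apply: (@continuous_comp _ _ _ (fun p : R * R => cx p.1 p.2 : C)
   (fun t : C => tri n p q (t ^+ p * a) (t ^+ q * b))).
  exact: cx_continuous.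
exact: differentiable_continuous (tri_curve_differentiable p q a b _).
Qed.

Lemma vle_tri p q (a b t : C) : (p <= q)%N -> rabs t <= 1 ->
  vle (tri n p q (t ^+ p * a) (t ^+ q * b)) (rabs t ^+ p * (rabs a + rabs b)).
Proof.
move=> pq t1 j; have t0 := rabs_ge0 t.
have sl k : rabs (slot R n k ord0 j) <= 1.
  rewrite mxE; case: eqP => _; last by rewrite rabs0.
  by rewrite rabsX rabsN rabs1 expr1n.
have tk k (c : C) : (p <= k)%N ->
   rabs ((t ^+ k * c) * slot R n k ord0 j) <= rabs t ^+ p * rabs c.
  move=> pk; rewrite rabsM -[leRHS]mulr1; apply: ler_pM; rewrite ?rabs_ge0 //.
  rewrite rabsM rabsX; apply: ler_wpM2r; first exact: rabs_ge0.
  exact: ler_wiXn2l.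
have -> : tri n p q (t ^+ p * a) (t ^+ q * b) ord0 j =
    (t ^+ p * a) * slot R n p ord0 j + (t ^+ q * b) * slot R n q ord0 j.
  by rewrite !mxE.
apply: le_trans (rabsD _ _) _; rewrite mulrDr; apply: lerD; exact: tk.
Qed.

(** The functions linrec _ M 0, bounded on G by [linrec_bound], obey nearly the
same bound at the midpoint c of two points of the slice: h(t) = wscale t^-1 (Gm t)
lies in G for |t| = 1 and tends to c as t -> 0, because the error O(|t|^(2p)) in
Gm t beats the factor |t|^-(j+1), j + 1 <= n < 2p. *)
Lemma slice_midpoint_bound p q (a b a' b' : C) : (0 < p)%N -> (p <= q)%N ->
  (n < p.*2)%N -> class_E (@symmetrized_polydisc R n) ->
  symmetrized_polydisc (tri n p q a b) -> symmetrized_polydisc (tri n p q a' b') ->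
  forall M, re (linrec (tri n p q ((a + a') / 2) ((b + b') / 2)) M 0) - 1
     <= 2 ^+ n * M.+1%:R ^+ n.
Proof.
move=> p0 pq np [_ cE] S1 S2 M.
pose x (t : C) : V := tri n p q (t ^+ p * a) (t ^+ q * b).
pose y (t : C) : V := tri n p q (t ^+ p * a') (t ^+ q * b').
pose c : V := tri n p q ((a + a') / 2) ((b + b') / 2).
pose w (t : C) : V := tri n p q (t ^+ p * ((a' - a) / 2)) (t ^+ q * ((b' - b) / 2)).
pose K := [set x t | t in [set t : C | rabs t <= 1]] `|`
          [set y t | t in [set t : C | rabs t <= 1]].
have cK : compact K by apply: compactU; exact: slice_disc_compact.
have KS : K `<=` @symmetrized_polydisc R n.
  move=> _ [] [t t1 <-]; rewrite /x /y -wscale_tri; exact: symmetrized_polydisc_wscale.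
have [D' [[oD _ _] KD DS [G [[oG _ _] cG]]]] := cE K cK KS.
move=> [f [g [[hf hg] fDG gGD gf fg]]].
have xD t : rabs t <= 1 -> D' (x t) by move=> t1; apply: KD; left; exists t.
have yD t : rabs t <= 1 -> D' (y t) by move=> t1; apply: KD; right; exists t.
have q0 : (0 < q)%N by exact: leq_trans pq.
have D0 : D' 0.
  have := xD 0; rewrite rabs0 ler01 /x !expr0n !gtn_eqF // !mul0r.
  by rewrite /tri !scale0r addr0; exact.
have [de de0 [L L0 mid]] := biholomorphic_midpoint oD oG D0 hf hg fDG gf.
pose Gm t : V := g (2^-1 *: (f (x t) + f (y t))).
have GmG t : rabs t <= 1 -> G (2^-1 *: (f (x t) + f (y t))).
  by move=> t1; apply: convex_midpoint => //; apply: fDG; [exact: xD | exact: yD].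
have GmS t : rabs t <= 1 -> symmetrized_polydisc (Gm t).
  by move=> t1; apply: DS; apply: gGD; exact: GmG.
pose X := Num.max (rabs a + rabs b)
                  (rabs ((a' - a) / 2) + rabs ((b' - b) / 2)).
have X0 : 0 <= X by rewrite le_max addr_ge0 ?rabs_ge0.
have xX t : rabs t <= 1 -> vle (x t) (rabs t ^+ p * X).
  move=> t1; apply: vle_trans (vle_tri _ _ pq t1).
  by apply: ler_wpM2l; [exact: exprn_ge0 (rabs_ge0 _) | rewrite le_max lexx].
have wX t : rabs t <= 1 -> vle (w t) (rabs t ^+ p * X).
  move=> t1; apply: vle_trans (vle_tri _ _ pq t1).
  by apply: ler_wpM2l; [exact: exprn_ge0 (rabs_ge0 _) | rewrite le_max lexx orbT].
have xw t : x t + w t = wscale t c.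
  by rewrite wscale_tri; apply/rowP => j; rewrite !mxE; field.
have xww t : x t + w t + w t = y t.
  by apply/rowP => j; rewrite !mxE; field.
have small t : rabs t <= 1 -> rabs t * X <= de ->
    vle (Gm t - wscale t c) (L * (rabs t ^+ p * X) ^+ 2).
  move=> t1 tX; have t0 := rabs_ge0 t.
  have tp : rabs t ^+ p * X <= de.
    apply: le_trans tX; apply: ler_wpM2r => //.
    by rewrite -[leRHS]expr1; apply: ler_wiXn2l.
  have := mid (x t) (w t) (rabs t ^+ p * X) (vle_trans tp (xX t t1))
     (vle_trans tp (wX t t1)) (wX t t1).
  by rewrite !add0r xww xw; apply; rewrite mulr_ge0 // exprn_ge0.
pose h t : V := wscale t^-1 (Gm t).
pose Q (t : C) : C := if t == 0 then linrec c M 0 else linrec (h t) M 0.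
have Q0 : Q 0 = linrec c M 0 by rewrite /Q eqxx.
have hc t : t != 0 -> rabs t <= 1 -> rabs t * X <= de ->
    vle (h t - c) (L * X ^+ 2 * rabs t).
  move=> tn0 t1 tX j; have tt : 0 < rabs t by rewrite rabs_gt0.
  have -> : (h t - c) ord0 j = t^-1 ^+ j.+1 * (Gm t - wscale t c) ord0 j.
    rewrite /h !mxE mulrBr; congr (_ - _).
    by rewrite mulrA -exprMn mulVf // expr1n mul1r.
  rewrite rabsM rabsX rabsV // exprVn.
  apply: le_trans (_ : (rabs t ^+ j.+1)^-1 * (L * (rabs t ^+ p * X) ^+ 2) <= _).
    by apply: ler_wpM2l; [rewrite invr_ge0 exprn_ge0 // ltW | exact: small].
  rewrite mulrC ler_pdivrMr ?exprn_gt0 //.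
  have -> : L * (rabs t ^+ p * X) ^+ 2 = L * X ^+ 2 * rabs t ^+ (p * 2).
    by rewrite exprMn -exprM [_ * X ^+ 2]mulrC mulrA.
  rewrite -[leRHS]mulrA -exprS; apply: ler_wpM2l.
    by rewrite mulr_ge0 // sqr_ge0.
  apply: ler_wiXn2l; rewrite ?t1 ?ltW //.
  by have := ltn_ord j; move: np; rewrite -muln2; lia.
(* 0 is the exceptional point of [circle_mean]: there Q is only continuous. *)
have cQ : rcont Q 0.
  move=> e e0; have [d d0 hd] := linrec_cont c M 0 e0.
  pose P := L * X ^+ 2 + X + 1.
  have LX : 0 <= L * X ^+ 2 by rewrite mulr_ge0 ?sqr_ge0.
  have P0 : 0 < P by rewrite /P; lra.
  exists (Num.min 1 (Num.min (d / P) (de / P))).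
    by rewrite !lt_min ltr01 !divr_gt0.
  move=> t; rewrite subr0 !lt_min !ltr_pdivlMr // => /and3P[t1 td tde].
  have t0 := rabs_ge0 t.
  rewrite Q0 /Q; have [_|tn0] := eqVneq t 0; first by rewrite subrr rabs0 ltW.
  have tX0 : 0 <= rabs t * X by rewrite mulr_ge0.
  have tLX : 0 <= rabs t * (L * X ^+ 2) by rewrite mulr_ge0.
  apply: hd; apply: vle_trans (hc t tn0 _ _); rewrite /P in td tde; lra.
have dQ t : 0 < rabs (t - 0) <= 1 -> derivable Q t 1.
  rewrite subr0 => /andP[tp t1]; have tn0 : t != 0 by rewrite -rabs_gt0.
  apply: (@near_eq_derivable _ _ _ (fun t => linrec (h t) M 0 : C)).
    have : \forall u \near t, u != 0.
      apply/nbhs_ballP; exists `|t|; first by rewrite /= normr_gt0.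
      by move=> u; rewrite /ball /=; apply: contraTneq => ->; rewrite subr0 ltxx.
    by apply: filterS => u /negbTE u0; rewrite /Q u0.
  apply/derivable1_diffP; apply: linrec_differentiable => k.
  have dfx : differentiable (fun t => f (x t)) t.
    apply: (@differentiable_comp C C V V x f).
      exact: tri_curve_differentiable.
    by apply: hf; exact: xD.
  have dfy : differentiable (fun t => f (y t)) t.
    apply: (@differentiable_comp C C V V y f).
      exact: tri_curve_differentiable.
    by apply: hf; exact: yD.
  have dm : differentiable (fun t => 2^-1 *: (f (x t) + f (y t))) t.
    apply: (@differentiableZ C C V (fun t => f (x t) + f (y t))).
    by apply: (@differentiableD C C V (fun t => f (x t)) (fun t => f (y t))).
  have dG : differentiable Gm t.
    apply: (@differentiable_comp C C V V
      (fun t => 2^-1 *: (f (x t) + f (y t))) g); first exact: dm.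
    by apply: hg; exact: GmG.
  have dGk : differentiable (fun t => Gm t ord0 k : C) t.
    apply: (@differentiable_comp C C V C Gm (fun N => N ord0 k)).
      exact: dG.
    exact: differentiable_coord.
  have -> : (fun t => h t ord0 k : C) = (fun t => t^-1 ^+ k.+1 * Gm t ord0 k).
    by apply/funext => u; rewrite /h mxE.
  apply: (@differentiableM C C (fun t => t^-1 ^+ k.+1)
    (fun t => Gm t ord0 k)); last exact: dGk.
  apply: (@differentiable_comp C C C C (fun t : C => t^-1)
    (fun u : C => u ^+ k.+1)); first exact: (@differentiable_Rinv C t tn0).
  apply: (@derivable1_diffP C C (fun u : C => u ^+ k.+1) _).1.
  exact: exprn_derivable.
have [z z1] := circle_mean ltr01 ltr01 dQ cQ.
rewrite subr0 in z1; rewrite Q0 => /ltW hz; apply: le_trans hz _.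
apply: le_trans (ler_norm _) _; apply: le_trans (re_rabs _) _.
have zn0 : z != 0 by rewrite -rabs_gt0 z1.
rewrite rabs_le /Q (negbTE zn0).
have -> : cx (2 ^+ n * M.+1%:R ^+ n) 0 = 2 ^+ n * M.+1%:R ^+ n :> C.
  have nat_cx k : cx k%:R 0 = k%:R :> C.
    by elim: k => // k IH; rewrite -!natr1 -IH -cx1 cxD addr0.
  by rewrite -!natrX -!natrM nat_cx.
apply: linrec_bound; apply: symmetrized_polydisc_wscale.
  by rewrite rabsV // z1 invr1.
by apply: GmS; rewrite z1.
Qed.

End Main.

(** A stable trinomial with 1 + Re a + Re b < 0 excludes the exhaustion: averaging
its point with the conjugate one gives real coefficients -A and -B, where
[slice_midpoint_bound] and [tri_linrec_lower] are incompatible. *)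
Lemma stable_trinomial_class_E (R : realType) (n d k : nat) (A B A' B' : R) :
  (0 < d)%N -> (0 < k)%N -> (d.+1 * k <= n)%N -> (n < (d * k).*2)%N ->
  0 <= A -> 0 <= B -> 1 < A + B ->
  stable_trinomial d (cx (- A) A') (cx (- B) B') ->
  ~ class_E (@symmetrized_polydisc R n).
Proof.
move=> d0 k0 dk nd A0 B0 AB st cE.
have hdk : (d * k <= d.+1 * k)%N by rewrite leq_mul2r leqnSn orbT.
have p0 : (0 < d * k)%N by rewrite muln_gt0 d0.
have hp : (0 < d * k <= n)%N by rewrite p0 (leq_trans hdk).
have hq : (0 < d.+1 * k <= n)%N by rewrite (leq_trans p0).
have n0 : (0 < n)%N by apply: leq_trans dk; rewrite muln_gt0.
have S1 := stable_tri_mem d0 k0 dk st.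
have S2 := stable_tri_mem d0 k0 dk (stable_cj st).
have bd := slice_midpoint_bound p0 hdk nd cE S1 S2.
have half (u v : R) : (cx u v + cj (cx u v)) / 2 = cx u 0.
  rewrite /cj re_cx im_cx cxD subrr.
  have -> : cx (u + u) 0 = cx u 0 * 2.
    by rewrite -[2]/(1 + 1) -cx1 cxD cxM; congr cx; ring.
  by rewrite mulfK // pnatr_eq0.
rewrite !half in bd.
have [L] := exp_beats_poly (2 ^+ n + 1) n AB.
apply/negP; rewrite -leNgt.
have := tri_linrec_lower hp hq A0 B0 AB (n * L) n0.
have -> : ((n * L + n.-1 - 0) %/ n = L)%N.
  by rewrite subn0 mulnC divnMDl // divn_small ?prednK // addn0.
move=> lo.
have {}lo : (A + B) ^+ L <=
    re (linrec (tri n (d * k) (d.+1 * k) (cx (- A) 0) (cx (- B) 0)) (n * L) 0).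
  by move: lo; rewrite -[(_ <= _)%R]/(_ <= _ :> R[i])%R lecE => /andP[_].
have := bd (n * L)%N.
have : 1 <= (n * L).+1%:R ^+ n :> R by apply: exprn_ege1; rewrite ler1n.
rewrite mulrDl mul1r; lra.
Qed.

Theorem proposition4p7 (R : realType) (n : nat) (hn : (3 <= n)%N) :
  ~ class_E (@symmetrized_polydisc R n).
Proof.
(* The first alternative fails exactly for n = 4, 5 and 8. *)
have [[k [k0 k1 k2]]|[k [k0 k1 k2]]] :
    (exists k, [/\ (0 < k)%N, (3 * k <= n)%N & (n < (2 * k).*2)%N]) \/
    (exists k, [/\ (0 < k)%N, (4 * k <= n)%N & (n < (3 * k).*2)%N]).
- have [n9|n9] := leqP 9 n; first by left; exists (n %/ 3)%N; split; lia.
  have [n8|n8] := eqVneq n 8; first by right; exists 2%N; split; lia.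
  have [n45|n45] := boolP ((n == 4) || (n == 5))%N.
    by right; exists 1%N; split; lia.
  by left; exists (n %/ 3)%N; split; lia.
- have h := @stable_trinomial_class_E R n 2 k (246 / 343) (2 / 7) _ _ isT k0 k1 k2.
  by apply: h; [lra | lra | lra | exact: stable_cubic].
- have h := @stable_trinomial_class_E R n 3 k (1233 / 1936) (8 / 22) _ _ isT k0 k1 k2.
  by apply: h; [lra | lra | lra | exact: stable_quartic].
Qed.
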